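(* Let $C$ be the Shalom--Tao constant and $I(n,d)$ the Shalom--Tao index bound (as described in the context). For $d\in\mathbb{N}$ set \[ \varepsilon_d=\min\left\{\frac{1}{2^{3C^{4d}}\,g(C^{d})^{C^{2d}}},\ \frac{1}{\exp(d\exp(Cd^C))}\right\}. \] Then for every $d\in\mathbb{N}$ the following hold. (1) If $G$ is a group with finite generating set $X$, and if $s_n(G,X)<\varepsilon_d n^d$ for some $n\in\mathbb{N}$, then $G$ has a nilpotent subgroup of index at most $I(n,d)$, and $\deg(G)\le d-1$. (2) If $G$ is a group with $\deg(G)\ge d$ and $X$ is a finite generating set for $G$, then $s_n(G,X)\ge\varepsilon_d n^d$ for every $n\in\mathbb{N}$.
   Context: $\mathbb{N}$ is the set of strictly positive integers. For a group $G$ generated by a finite subset $X$, $s_n(G,X)$ is the number of elements of $G$ that can be expressed as a product of at most $n$ elements of $X\cup X^{-1}$. The growth degree is $\deg(G):=\limsup_{n\to\infty}\frac{\log s_n(G,X)}{\log n}\in[0,\infty]$, which is independent of $X$ (it is infinite if $G$ is not of polynomial growth). The Hirsch length of a finitely generated nilpotent group $H$ of class $c$ is $\sum_{i=1}^c r(i)$, where $r(i)$ is the torsion-free rank of $\gamma_i(H)/\gamma_{i+1}(H)$ and $\gamma_i(H)$ is the lower central series. $g(k)$ denotes the maximum order of a finite subgroup of $\mathrm{GL}_k(\mathbb{Z})$; for real $x\ge 0$, read $g(x)$ as $g(\lfloor x\rfloor)$. The Shalom--Tao theorem (a known result) states: there exist an absolute constant $C$ and a function $I(n,d)$ such that if $G$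 is a group with finite generating set $X$, and if $s_n(G,X)\le n^d$ for some $d\ge1$ and some integer $n\ge\exp(\exp(Cd^C))$, then $G$ has a nilpotent subgroup of index at most $I(n,d)$ and Hirsch length and class at most $C^d$, whence $\deg(G)\le C^{2d}$. Throughout, $C$ and $I(n,d)$ are a fixed constant and function for which this theorem holds. *)

(* Defs.v *)
From mathcomp Require Export all_boot all_order all_algebra finmap.
From mathcomp Require Export all_classical all_reals all_analysis.

Set Implicit Arguments.
Unset Strict Implicit.
Unset Printing Implicit Defensive.

Import Order.TTheory GRing.Theory Num.Theory.

Local Open Scope classical_set_scope.
Local Open Scope ring_scope.

Section Groups.
Variable G : groupType.
Implicit Types (H A B X : set G) (x y : G).

Definition is_subgroup H : Prop :=
  [/\ H 1%g, forall x y, H x -> H y -> H (x * y)%g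
    & forall x, H x -> H x^-1%g].

Definition generated X : set G := smallest is_subgroup X.

Definition generating_set X : Prop := finite_set X /\ generated X = setT.

Definition word_ball X (n : nat) : set G :=
  [set (\prod_(x <- w) x)%g | w in
    [set w : seq G | (size w <= n)%N /\
       forall x, x \in w -> X x \/ X x^-1%g]].

Definition growth X (n : nat) : nat := #|` fset_set (word_ball X n)|.

Definition left_cosets H : set (set G) :=
  [set [set (x * h)%g | h in H] | x in [set: G]].

Definition index_le (R : realType) H (b : R) : Prop :=
  finite_set (left_cosets H) /\ #|` fset_set (left_cosets H)|%:R <= b.

(* The numbering starts at 0: [lcs H i] is the term usually written
   gamma_(i+1)(H). *)
Fixpoint lcs H (i : nat) : set G :=
  if i is j.+1 then
    generated [set [~ p.1, p.2]%g | p in lcs H j `*` H]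
  else H.

Definition nilpotent_of_class H (c : nat) : Prop :=
  lcs H c = [set 1%g] /\ forall c', lcs H c' = [set 1%g] -> (c <= c')%N.

Definition is_nilpotent H : Prop := exists c, nilpotent_of_class H c.

Definition expgz x (z : int) : G :=
  match z with Posz n => (x ^+ n)%g | Negz n => (x ^- n.+1)%g end.

Definition independent_mod B (r : nat) (x : 'I_r -> G) : Prop :=
  forall e : 'I_r -> int,
    B (\prod_(i < r) expgz (x i) (e i))%g -> forall i, e i = 0.

(* [B] is meant to be a normal subgroup of [A] with [A / B] abelian: the
   torsion-free rank of [A / B] is then the maximal size of a family of
   elements which are linearly independent over the integers. *)
Definition has_torsion_free_rank A B (r : nat) : Prop :=
  (exists x : 'I_r -> G, (forall i, A (x i)) /\ independent_mod B x) /\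
  (forall (s : nat) (x : 'I_s -> G),
     (forall i, A (x i)) -> independent_mod B x -> (s <= r)%N).

Definition has_hirsch_length H (h : nat) : Prop :=
  exists (c : nat) (r : nat -> nat),
    [/\ nilpotent_of_class H c,
        forall i, (i < c)%N -> has_torsion_free_rank (lcs H i) (lcs H i.+1) (r i)
      & h = (\sum_(i < c) r i)%N].

End Groups.

Definition growth_exponent (R : realType) (G : groupType) (X : set G) : \bar R :=
  limn_esup (fun n : nat => (ln (growth X n)%:R / ln n%:R)%:E).

(* Only meaningful for a finitely generated [G]; by [growth_degreeE] below the
   choice of a finite generating set does not matter. *)
Definition growth_degree (R : realType) (G : groupType) : \bar R :=
  growth_exponent R (xget set0 [set X : set G | generating_set X]).

Section GrowthDegree.
Variables (R : realType) (G : groupType).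
Implicit Types (X Y : set G).

Lemma word_ball0 X n : word_ball X n 1%g.
Proof. by exists [::]; rewrite ?big_nil. Qed.

Lemma word_ballM X m n x y :
  word_ball X m x -> word_ball X n y -> word_ball X (m + n) (x * y)%g.
Proof.
move=> [u [su Xu] <-] [v [sv Xv] <-]; exists (u ++ v); last by rewrite big_cat.
split; first by rewrite size_cat leq_add.
by move=> z; rewrite mem_cat => /orP[/Xu|/Xv].
Qed.

Lemma word_ballV X n x : word_ball X n x -> word_ball X n x^-1%g.
Proof.
move=> [u [su Xu] <-]; elim: u n su Xu => [|a u IH] n su Xu.
  by rewrite big_nil invg1; exact: word_ball0.
case: n su => // n su; rewrite big_cons invgM -addn1.
apply: word_ballM.
  by apply: IH => // z zu; apply: Xu; rewrite inE zu orbT.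
exists [:: a^-1%g]; last by rewrite big_seq1.
split=> // z; rewrite inE => /eqP ->; rewrite invgK or_comm.
by apply: Xu; rewrite inE eqxx.
Qed.

Lemma word_ball_le X m n : (m <= n)%N -> word_ball X m `<=` word_ball X n.
Proof. by move=> mn x [u [su Xu] <-]; exists u => //; split=> //; exact: leq_trans mn. Qed.

Lemma word_ball_sub X Y m n :
  X `<=` word_ball Y m -> word_ball X n `<=` word_ball Y (m * n).
Proof.
move=> XY x [u [su Xu] <-]; elim: u n su Xu => [|a u IH] n su Xu.
  by rewrite big_nil; exact: word_ball0.
case: n su => // n su; rewrite big_cons mulnS; apply: word_ballM.
  have [/XY//|/XY/word_ballV] := Xu a (mem_head _ _).
  by rewrite invgK.
by apply: IH => // z zu; apply: Xu; rewrite inE zu orbT.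
Qed.

Lemma finite_word_ball X n : finite_set X -> finite_set (word_ball X n).
Proof.
move=> fX; elim: n => [|n IH].
  apply: (sub_finite_set _ (finite_set1 1%g)) => x [[|a u] [su _] <-] //.
  by rewrite big_nil.
pose Z := [set 1%g] `|` (X `|` [set x^-1%g | x in X]).
have fZ : finite_set Z.
  by rewrite !finite_setU; split=> //; split=> //; exact: finite_image.
apply: (sub_finite_set _ (finite_image2 (fun x y : G => (x * y)%g) fZ IH)).
move=> x [[|a u] [su Xu] <-].
  rewrite big_nil; exists 1%g; first by left.
  by exists 1%g; [exact: word_ball0 | rewrite mulg1].
rewrite big_cons; exists a.
  right; have [Xa|Xa] := Xu a (mem_head _ _); [by left|right].
  by exists a^-1%g; rewrite ?invgK.
exists (\prod_(x <- u) x)%g => //; exists u => //; split=> // z zu.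
by apply: Xu; rewrite inE zu orbT.
Qed.

Lemma generated_word_ball X x : generated X x -> exists n, word_ball X n x.
Proof.
move=> gx; apply: (gx [set y | exists n, word_ball X n y]).
split=> [|y Xy]; last first.
  exists 1%N, [:: y]; last by rewrite big_seq1.
  by split=> // z; rewrite inE => /eqP ->; left.
split=> [|y z [m my] [n nz]|y [n ny]].
- by exists 0%N; exact: word_ball0.
- by exists (m + n)%N; exact: word_ballM.
- by exists n; exact: word_ballV.
Qed.

Lemma generating_ball X Y : generating_set X -> generating_set Y ->
  exists m, X `<=` word_ball Y m.+1.
Proof.
move=> [fX _] [_ gY].
have /choice[f fP] : forall x, exists n, word_ball Y n x.
  by move=> x; apply: generated_word_ball; rewrite gY.
exists (\max_(x <- fset_set X) f x)%N => x Xx.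
apply: word_ball_le (fP x); apply: leqW.
by apply: leq_bigmax_seq => //; rewrite in_fset_set// inE.
Qed.

Lemma growth_gt0 X n : finite_set X -> (0 < growth X n)%N.
Proof.
move=> fX; rewrite cardfs_gt0; apply/fset0Pn; exists 1%g.
rewrite in_fset_set ?inE; first exact: word_ball0.
exact: finite_word_ball.
Qed.


Lemma growth_exponent_le X Y : generating_set X -> generating_set Y ->
  (growth_exponent R X <= growth_exponent R Y)%E.
Proof.
move=> gX gY; have [m XY] := generating_ball gX gY.
have le_s n : (growth X n <= growth Y (m.+1 * n))%N.
  apply: fsubset_leq_card; rewrite -fset_set_sub.
  - exact: word_ball_sub.
  - by apply: finite_word_ball; case: gX.
  - by apply: finite_word_ball; case: gY.
have [fX fY] : finite_set X /\ finite_set Y by case: gX; case: gY.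
pose u (Z : set G) n : R := ln (growth Z n)%:R / ln n%:R.
have u_ge0 n : 0 <= u Y n.
  apply: divr_ge0; first by rewrite ln_ge0// ler1n growth_gt0.
  by case: n => [|n]; [rewrite ln0 | rewrite ln_ge0// ler1n].
rewrite leNgt; apply/negP => /ereal_inf_ltP[_ [V [N _ NV] <-]].
set y := ereal_sup _ => yX.
have y_ub n : (N <= n)%N -> ((u Y n)%:E <= y)%E.
  by move=> Nn; apply: ereal_sup_ubound; exists n => //; exact: NV.
have : (0%:E <= y)%E by apply: le_trans (y_ub N _); rewrite ?lee_fin.
case: y yX y_ub => [c||] yX y_ub //; last by rewrite ltNge leey in yX.
rewrite lee_fin => c0; move: yX; rewrite ltNge => /negP; apply.
apply/lee_addgt0Pr => e e0.
pose N' := maxn (maxn N 2) (Num.truncn (expR (c * ln m.+1%:R / e))).+1.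
apply: ge_ereal_inf; exists (ereal_sup [set (u X n)%:E | n in [set n | (N' <= n)%N]]).
  by exists [set n | (N' <= n)%N] => //; exists N'.
apply: ge_ereal_sup => _ [n /= N'n <-]; rewrite -EFinD lee_fin.
move: N'n; rewrite !geq_max -andbA => /and3P[Nn n2 n3].
have n0 : 0 < n%:R :> R by rewrite ltr0n (leq_trans _ n2).
have ln0 : 0 < ln n%:R :> R by rewrite ln_gt0// ltr1n.
rewrite ler_pdivrMr//.
have mn0 : 0 < m.+1%:R * n%:R :> R by rewrite mulr_gt0.
have : u Y (m.+1 * n)%N <= c.
  by rewrite -lee_fin; apply: y_ub; rewrite (leq_trans Nn)// leq_pmull.
have lnmn : ln (m.+1 * n)%:R = ln m.+1%:R + ln n%:R :> R.
  by rewrite natrM lnM ?posrE.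
have lnm : 0 <= ln m.+1%:R :> R by rewrite ln_ge0// ler1n.
rewrite /u lnmn ler_pdivrMr; last by rewrite ltr_wpDl.
move=> uc; have : ln (growth X n)%:R <= ln (growth Y (m.+1 * n))%:R :> R.
  by rewrite ler_ln ?posrE ?ltr0n ?growth_gt0// ler_nat.
move=> /le_trans; apply; apply: (le_trans uc).
rewrite mulrDr mulrDl addrC lerD2l -ler_pdivrMl// mulrC -[leLHS]expRK.
rewrite ler_ln ?posrE ?expR_gt0//.
by apply/ltW/(lt_le_trans (truncnS_gt _)); rewrite ler_nat.
Qed.

Lemma growth_degreeE X : generating_set X ->
  growth_degree R G = growth_exponent R X.
Proof.
move=> gX; rewrite /growth_degree.
have gY := @xgetPex _ set0 [set Z : set G | generating_set Z] (ex_intro _ X gX).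
by apply/eqP; rewrite eq_le !growth_exponent_le.
Qed.

End GrowthDegree.

Definition finite_GLZ_subgroup (k : nat) (S : {fset 'M[int]_k}) : Prop :=
  [/\ forall M, M \in S -> M \in unitmx,
      1%:M \in S,
      forall M N, M \in S -> N \in S -> M *m N \in S
    & forall M, M \in S -> invmx M \in S].

Definition is_max_GLZ_order (k m : nat) : Prop :=
  (exists2 S : {fset 'M[int]_k}, finite_GLZ_subgroup S & #|` S| = m) /\
  (forall S : {fset 'M[int]_k}, finite_GLZ_subgroup S -> (#|` S| <= m)%N).

(* The maximum exists by Minkowski's theorem on finite subgroups of GL_k(Z). *)
Definition max_GLZ_order (k : nat) : nat := xget 0%N (is_max_GLZ_order k).

(* [C] is required to be positive so that the real powers of [C] and the power
   [d `^ C] in the statement have their usual meaning. *)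
Definition shalom_tao (R : realType) (C : R) (I : nat -> R -> R) : Prop :=
  0 < C /\
  forall (G : groupType) (X : set G), generating_set X ->
  forall (d : R) (n : nat), 1 <= d ->
    expR (expR (C * d `^ C)) <= n%:R ->
    (growth X n)%:R <= n%:R `^ d ->
    (exists (H : set G) (c h : nat),
       [/\ is_subgroup H, index_le H (I n d),
          nilpotent_of_class H c /\ c%:R <= C `^ d
        & has_hirsch_length H h /\ h%:R <= C `^ d]) /\
    (growth_degree R G <= (C `^ (2 * d))%:E)%E.

Definition epsilon (R : realType) (C : R) (d : nat) : R :=
  Num.min
    (1 / (2 `^ (3 * C ^+ (4 * d)) *
          (max_GLZ_order (Num.truncn (C ^+ d)))%:R `^ (C ^+ (2 * d))))
    (1 / expR (d%:R * expR (C * d%:R `^ C))).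

(* Main.v *)
From HB Require Import structures.
Require Import Defs.
From mathcomp Require Import all_boot all_order all_algebra finmap.
From mathcomp Require Import all_classical all_reals all_analysis.
From mathcomp Require Import zify ring.

Set Implicit Arguments.
Unset Strict Implicit.
Unset Printing Implicit Defensive.

Import Order.TTheory GRing.Theory Num.Theory.
Local Open Scope classical_set_scope.
Local Open Scope ring_scope.

(** Write s_n for the growth of G with respect to X, and suppose that
    s_n < epsilon_d n^d for one n. The second term of the minimum defining
    epsilon_d puts n beyond the threshold of the Shalom-Tao theorem
    ([epsilon_threshold]), so G has a nilpotent subgroup H of finite index whose
    class c and Hirsch length h are at most C^d. What is left is a statement on
    virtually nilpotent groups, [virtually_nilpotent_growth]: either
    deg G <= d - 1, or d <= c h and n^d <= s_n (g(k) 8^d)^d for all n, where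
    h <= k. As c h <= C^(2d), the second alternative contradicts
    s_n < epsilon_d n^d, by the first term of the minimum
    ([epsilon_bound]). The second part of the theorem is the contrapositive of
    the first.

    For a finitely generated group K with lower central series gamma_i, let r_i
    be the torsion-free rank of gamma_i / gamma_(i+1) and D = sum_i i r_i. The
    quotient gamma_i / gamma_(i+1) is spanned by the left-normed commutators
    [y_1, ..., y_i] of generators; a maximal independent set of r_i of them is
    called a level basis. Two estimates relate growth to D.

    - Upper bound ([growth_upper_bound]): if some gamma_(c+1) is finite, then
      s_n = O(n^D). A word of length n is rewritten by collection. Pulling a
      letter of weight v to the left creates commutators, but a word with
      O(n^w) letters of weight w, for every w, keeps this property. The
      exponents of a level basis of weight i then take O(n^i) values, and all
      other exponents can be kept bounded.

    - Lower bound ([growth_lower_bound]): writing an exponent a < m^i in base m,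
      [y_1, ..., y_i]^a agrees modulo gamma_(i+1) with a product of commutators
      of powers y_j^b with b <= m, whose length is linear in m. Hence m^d
      elements have length O(m) as soon as d <= D, with a constant which depends
      on d only.

    The lower bound in G loses the index of the subgroup K to which it is applied,
    so this index has to be at most g(k), whereas the index of H is out of
    control. Let N be the normal core of H and A the quotient of N by its
    commutator subgroup, modulo torsion. It is free abelian of rank at most h
    ([abelianization_span], [steinitz], [free_basis]), and G acts on it by
    conjugation. Let K be the kernel of this action: G / K is a finite subgroup of
    GL_r(Z) with r <= h, whence [G : K] <= g(k) ([action_kernel]). The lower bound
    for K involves the lower central series of K itself, and the upper bound
    applies to K because gamma_(c+1)(K) is finite ([lcs_finite]): K acts
    trivially on each gamma_i(N) / gamma_(i+1)(N) modulo torsion, and the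
    transfer extends these quotient maps, up to a factor, to a central series of K
    whose terms contain those of N with finite index. Thus either D(K) < d, and
    deg G <= d - 1, or the lower bound holds with exponent d. Applying the upper
    bound to H as well gives either deg G <= d - 1 or
    d <= D(H) <= c h. *)

(** * Subgroups and abelian sections *)

Section Subgroups.
Variable G : groupType.
Implicit Types (A B H K X : set G) (x y z : G).

Lemma subg1 A : is_subgroup A -> A 1%g. Proof. by case. Qed.
Lemma subgM A x y : is_subgroup A -> A x -> A y -> A (x * y)%g.
Proof. by case=> _ + _; apply. Qed.
Lemma subgV A x : is_subgroup A -> A x -> A x^-1%g.
Proof. by case=> _ _; apply. Qed.
Lemma subgVE A x : is_subgroup A -> A x^-1%g -> A x.
Proof. by move=> sA /(subgV sA); rewrite invgK. Qed.
Lemma subgX A x n : is_subgroup A -> A x -> A (x ^+ n)%g.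
Proof.
move=> sA Ax; elim: n => [|n IH]; first exact: subg1.
by rewrite expgS; apply: subgM.
Qed.
Lemma subgZ A x e : is_subgroup A -> A x -> A (expgz x e).
Proof. by move=> sA Ax; case: e => n /=; [|apply: subgV => //]; apply: subgX. Qed.
Lemma subgJ A x y : is_subgroup A -> A x -> A y -> A (x ^ y)%g.
Proof. by move=> sA Ax Ay; rewrite conjgE; do 2?[apply: subgM => //]; exact: subgV. Qed.
Lemma subgR A x y : is_subgroup A -> A x -> A y -> A [~ x, y]%g.
Proof. by move=> sA Ax Ay; rewrite commgEl; apply: subgM; [|exact: subgV|exact: subgJ]. Qed.
Lemma subg_prod A (I : Type) (r : seq I) (P : pred I) (F : I -> G) :
  is_subgroup A -> (forall i, P i -> A (F i)) -> A (\prod_(i <- r | P i) F i)%g.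
Proof. by move=> sA AF; apply: big_ind => //; [exact: subg1|move=> ? ?; exact: subgM]. Qed.
Lemma subg_prod_seq A (r : seq G) :
  is_subgroup A -> (forall x, x \in r -> A x) -> A (\prod_(x <- r) x)%g.
Proof.
move=> sA; elim: r => [_|x r IH Ar]; first by rewrite big_nil; exact: subg1.
rewrite big_cons; apply: subgM => //; first by apply: Ar; rewrite mem_head.
by apply: IH => y yr; apply: Ar; rewrite inE yr orbT.
Qed.

Lemma subgMr A x y : is_subgroup A -> A y -> A (x * y)%g -> A x.
Proof. by move=> sA Ay Axy; rewrite -[x](mulgK y); apply: subgM => //; exact: subgV. Qed.

Lemma generated_subgroup X : is_subgroup (generated X).
Proof.
split=> [A [[? ? ?] _]//|x y gx gy A AX|x gx A AX].
  by case: (AX) => -[_ + _] _; apply; [exact: gx|exact: gy].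
by case: (AX) => -[_ _ +] _; apply; exact: gx.
Qed.

Lemma sub_generated X : X `<=` generated X.
Proof. exact: sub_gen_smallest. Qed.

Lemma generated_sub X A : is_subgroup A -> X `<=` A -> generated X `<=` A.
Proof. by move=> sA XA; apply: smallest_sub. Qed.

Lemma word_ball_generated X n : word_ball X n `<=` generated X.
Proof.
move=> _ [w [_ wX] <-]; apply: subg_prod_seq; first exact: generated_subgroup.
move=> x /wX[/sub_generated//|/sub_generated]; apply: subgVE.
exact: generated_subgroup.
Qed.

Definition normalizes K B := forall x k, K k -> B x -> B (x ^ k)%g.

Definition abelian_section A B :=
  [/\ is_subgroup A, is_subgroup B, B `<=` A
    & forall x y, A x -> A y -> B [~ x, y]%g].

(** Choosing a representative in each coset makes A / B a subtype of G. Outside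
    of an abelian section every representative is 1, so that the group laws below
    hold for all A and B and the quotient can be declared as a [zmodType] without
    carrying a proof that B is normal in A. *)
Definition quo_rep A B x : G :=
  let x' := if `[< A x >] then x else 1%g in
  if `[< abelian_section A B >] then
    xget 1%g [set y | A y /\ B (x'^-1 * y)%g]
  else 1%g.

Lemma quo_repE A B x : abelian_section A B -> A x ->
  quo_rep A B x = xget 1%g [set y | A y /\ B (x^-1 * y)%g].
Proof. by move=> AB Ax; rewrite /quo_rep (asboolT AB) (asboolT Ax). Qed.

Lemma quo_rep_out A B x : ~ A x -> A 1%g -> quo_rep A B x = quo_rep A B 1%g.
Proof. by move=> nAx A1; rewrite /quo_rep /= (asboolF nAx) (asboolT A1). Qed.

Lemma quo_rep_triv A B x : ~ abelian_section A B -> quo_rep A B x = 1%g.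
Proof. by move=> nAB; rewrite /quo_rep (asboolF nAB). Qed.

Lemma quo_repP A B x : abelian_section A B -> A x ->
  A (quo_rep A B x) /\ B (x^-1 * quo_rep A B x)%g.
Proof.
move=> AB Ax; rewrite quo_repE//.
apply: (@xgetPex _ 1%g [set y | A y /\ B (x^-1 * y)%g]); exists x; split=> //.
by rewrite mulVg; case: AB => _ /subg1.
Qed.

Lemma quo_rep_eq A B x y : abelian_section A B -> A x -> A y ->
  B (x^-1 * y)%g -> quo_rep A B x = quo_rep A B y.
Proof.
move=> AB Ax Ay Bxy; rewrite !quo_repE//.
have sB : is_subgroup B by case: AB.
congr (xget _ _); apply/seteqP; split=> z /= [Az Bz]; split=> //.
  have -> : (y^-1 * z = (x^-1 * y)^-1 * (x^-1 * z))%g by rewrite !gnorm.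
  by apply: subgM => //; exact: subgV.
have -> : (x^-1 * z = (x^-1 * y) * (y^-1 * z))%g by rewrite !gnorm.
exact: subgM.
Qed.

Lemma quo_rep_in A B x : abelian_section A B -> A (quo_rep A B x).
Proof.
move=> AB; have [Ax|nAx] := pselect (A x); first by case: (quo_repP AB Ax).
have A1 : A 1%g by case: AB => /subg1.
rewrite quo_rep_out//.
by case: (quo_repP AB A1).
Qed.

Lemma quo_rep_id A B x : quo_rep A B (quo_rep A B x) == quo_rep A B x.
Proof.
have [AB|nAB] := pselect (abelian_section A B); last first.
  by rewrite !quo_rep_triv.
wlog Ax : x / A x => [IH|].
  have [/IH//|nAx] := pselect (A x).
  have A1 : A 1%g by case: AB => /subg1.
  by rewrite (quo_rep_out B nAx A1); exact: IH.
have [A1 B1] := quo_repP AB Ax; apply/eqP/esym; exact: quo_rep_eq.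
Qed.

Definition quo A B := {x : G | quo_rep A B x == x}.
HB.instance Definition _ A B := Choice.on (quo A B).
HB.instance Definition _ A B := SubType.on (quo A B).

Definition qproj A B x : quo A B :=
  exist (fun x => quo_rep A B x == x) (quo_rep A B x) (quo_rep_id A B x).

Lemma qproj_eq A B x y : abelian_section A B -> A x -> A y ->
  B (x^-1 * y)%g -> qproj A B x = qproj A B y.
Proof. by move=> AB Ax Ay Bxy; apply: val_inj; exact: quo_rep_eq. Qed.

Lemma qproj_val A B (u : quo A B) : qproj A B (val u) = u.
Proof. by apply: val_inj => /=; apply/eqP; exact: (valP u). Qed.

Lemma val_qproj A B x : abelian_section A B -> A x ->
  A (val (qproj A B x)) /\ B (x^-1 * val (qproj A B x))%g.
Proof. exact: quo_repP. Qed.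

Lemma quo_trivial A B (u v : quo A B) : ~ abelian_section A B -> u = v.
Proof.
move=> nAB; apply: val_inj; rewrite -(eqP (valP u)) -(eqP (valP v)).
by rewrite !quo_rep_triv.
Qed.

Lemma quo_in A B (u : quo A B) : abelian_section A B -> A (val u).
Proof. by move=> AB; rewrite -(eqP (valP u)); exact: quo_rep_in. Qed.

Definition quo_add A B (u v : quo A B) := qproj A B (val u * val v)%g.
Definition quo_opp A B (u : quo A B) := qproj A B (val u)^-1%g.

Lemma section_conj A B x y : abelian_section A B -> B x -> A y -> B (x ^ y)%g.
Proof.
move=> [sA sB BA AAB] Bx Ay; rewrite -[(x ^ y)%g](mulVKg x).
by apply: subgM => //; apply: AAB => //; exact: BA.
Qed.

Lemma quo_addE A B x y : abelian_section A B -> A x -> A y ->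
  qproj A B (x * y)%g = quo_add (qproj A B x) (qproj A B y).
Proof.
move=> AB Ax Ay; have [A1 B1] := val_qproj AB Ax; have [A2 B2] := val_qproj AB Ay.
have [sA sB BA _] := AB.
apply: qproj_eq => //; [exact: subgM|exact: subgM|].
set x' := val _ in A1 B1 *; set y' := val _ in A2 B2 *.
have -> : ((x * y)^-1 * (x' * y') = (x^-1 * x') ^ y * (y^-1 * y'))%g.
  by rewrite conjgE !gnorm.
by apply: subgM => //; exact: (section_conj AB).
Qed.

Lemma quo_addA A B : associative (@quo_add A B).
Proof.
move=> u v w; have [AB|nAB] := pselect (abelian_section A B); last exact: quo_trivial.
have [sA _ _ _] := AB.
rewrite -(qproj_val u) -(qproj_val v) -(qproj_val w) -!quo_addE ?mulgA//;
  do 2?[apply: subgM => //]; exact: quo_in.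
Qed.

Lemma quo_addC A B : commutative (@quo_add A B).
Proof.
move=> u v; have [AB|nAB] := pselect (abelian_section A B); last exact: quo_trivial.
have [sA _ _ AAB] := AB; have [Au Av] := (quo_in u AB, quo_in v AB).
rewrite -(qproj_val u) -(qproj_val v) -!quo_addE ?mulgA//.
apply: qproj_eq => //; [exact: subgM|exact: subgM|].
have -> : ((val u * val v)^-1 * (val v * val u) = [~ val v, val u])%g.
  by rewrite /commg /conjg !gnorm.
exact: AAB.
Qed.

Lemma quo_add0 A B : left_id (qproj A B 1%g) (@quo_add A B).
Proof.
move=> u; have [AB|nAB] := pselect (abelian_section A B); last exact: quo_trivial.
rewrite -{1}(qproj_val u) -quo_addE ?mul1g ?qproj_val//; last exact: quo_in.
by case: AB => /subg1.
Qed.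

Lemma quo_addN A B : left_inverse (qproj A B 1%g) (@quo_opp A B) (@quo_add A B).
Proof.
move=> u; have [AB|nAB] := pselect (abelian_section A B); last exact: quo_trivial.
have Au := quo_in u AB; have [sA _ _ _] := AB.
rewrite /quo_opp -{2}(qproj_val u) -quo_addE ?mulVg//; exact: subgV.
Qed.

HB.instance Definition _ A B := GRing.isZmodule.Build (quo A B)
  (@quo_addA A B) (@quo_addC A B) (@quo_add0 A B) (@quo_addN A B).

Lemma qprojM A B x y : abelian_section A B -> A x -> A y ->
  qproj A B (x * y)%g = qproj A B x + qproj A B y.
Proof. exact: quo_addE. Qed.

Lemma qproj_eq0 A B x : abelian_section A B -> A x -> qproj A B x = 0 <-> B x.
Proof.
move=> AB Ax; have [sA sB _ _] := AB; split=> [x0|Bx].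
  have A1 := subg1 sA; have [_] := val_qproj AB Ax; rewrite x0.
  have [_] := val_qproj AB A1; rewrite invg1 mul1g => B1 B2.
  by apply: subgVE => //; exact: subgMr B2.
apply/esym/qproj_eq => //; first exact: subg1.
by rewrite invg1 mul1g.
Qed.

Lemma qproj_surj A B (u : quo A B) : abelian_section A B ->
  exists2 x, A x & qproj A B x = u.
Proof. by move=> AB; exists (val u); [exact: quo_in|exact: qproj_val]. Qed.

End Subgroups.

Definition additive_on (G : groupType) (V : zmodType) (A : set G) (f : G -> V) :=
  forall x y, A x -> A y -> f (x * y)%g = f x + f y.

Section AdditiveOn.
Variables (G : groupType) (V : zmodType) (A : set G) (f : G -> V).
Hypotheses (sA : is_subgroup A) (fM : additive_on A f).

Lemma additive_on1 : f 1%g = 0.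
Proof.
have /eqP := fM (subg1 sA) (subg1 sA).
by rewrite mulg1 -subr_eq0 opprD addNKr oppr_eq0 => /eqP.
Qed.

Lemma additive_onV x : A x -> f x^-1%g = - f x.
Proof.
move=> Ax; apply/eqP; rewrite -subr_eq0 opprK; apply/eqP.
by rewrite -fM ?mulVg ?additive_on1//; exact: subgV.
Qed.

Lemma additive_onX x n : A x -> f (x ^+ n)%g = f x *+ n.
Proof.
move=> Ax; elim: n => [|n IH]; first by rewrite additive_on1 mulr0n.
by rewrite expgS fM ?IH ?mulrS//; exact: subgX.
Qed.

Lemma additive_onZ x e : A x -> f (expgz x e) = f x *~ e.
Proof.
move=> Ax; case: e => n /=; first by rewrite additive_onX.
by rewrite additive_onV ?additive_onX//; exact: subgX.
Qed.

Lemma additive_on_prod (I : Type) (r : seq I) (P : pred I) (F : I -> G) :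
  (forall i, P i -> A (F i)) ->
  f (\prod_(i <- r | P i) F i)%g = \sum_(i <- r | P i) f (F i).
Proof.
move=> AF; elim: r => [|i r IH]; first by rewrite !big_nil additive_on1.
rewrite !big_cons; case: ifP => // Pi; rewrite fM ?IH//; first exact: AF.
exact: subg_prod.
Qed.

Lemma additive_onJ x y : A x -> A y -> f (x ^ y)%g = f x.
Proof.
move=> Ax Ay; rewrite conjgE !fM ?additive_onV//; do ?[by apply: subgV|by apply: subgM].
by rewrite addrC addrK.
Qed.

End AdditiveOn.

(** * Integer linear algebra in abelian groups *)

Section IntegerSpan.
Variable V : zmodType.
Implicit Types (s t : seq V) (u v w : V).

Fixpoint zspan s v : Prop :=
  if s is u :: s' then exists a : int, zspan s' (v - u *~ a) else v = 0.

(** Membership in the span over the rationals, expressed inside the group. *)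
Definition qspan s v := exists2 m, (0 < m)%N & zspan s (v *+ m).

(** Linear independence over the integers, in the triangular form suited to the
    greedy extraction of a maximal independent sublist. *)
Fixpoint zindep s : Prop :=
  if s is u :: s' then zindep s' /\ forall a : int, zspan s' (u *~ a) -> a = 0
  else True.

Lemma zspan0 s : zspan s 0.
Proof. by elim: s => [//|u s IH] /=; exists 0; rewrite mulr0z subr0. Qed.

Lemma zspanD s v w : zspan s v -> zspan s w -> zspan s (v + w).
Proof.
elim: s v w => [|u s IH] v w /=; first by move=> -> ->; rewrite addr0.
move=> [a sv] [b sw]; exists (a + b).
by rewrite mulrzDr opprD addrACA; apply: IH.
Qed.

Lemma zspanN s v : zspan s v -> zspan s (- v).
Proof.
elim: s v => [|u s IH] v /=; first by move=> ->; rewrite oppr0.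
by move=> [a sv]; exists (- a); rewrite mulrNz -opprD; apply: IH.
Qed.

Lemma zspanB s v w : zspan s v -> zspan s w -> zspan s (v - w).
Proof. by move=> sv sw; apply: zspanD sv (zspanN sw). Qed.

Lemma zspanMn s v n : zspan s v -> zspan s (v *+ n).
Proof.
by move=> sv; elim: n => [|n IH]; rewrite ?mulr0n ?mulrS; [exact: zspan0|exact: zspanD].
Qed.

Lemma zspanMz s v (a : int) : zspan s v -> zspan s (v *~ a).
Proof. by case: a => n sv /=; [|apply: zspanN]; exact: zspanMn. Qed.

Lemma zspan_absz s v (a : int) : zspan s (v *~ a) -> zspan s (v *+ `|a|%N).
Proof. by case: a => n //= /zspanN; rewrite opprK. Qed.

Lemma zspan_cons u s v : zspan s v -> zspan (u :: s) v.
Proof. by exists 0; rewrite mulr0z subr0. Qed.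

Lemma zspan_mem s v : v \in s -> zspan s v.
Proof.
elim: s => // u s IH; rewrite inE => /predU1P[->|/IH]; last exact: zspan_cons.
by exists 1; rewrite mulr1z subrr; exact: zspan0.
Qed.

Lemma zspan_qspan s v : zspan s v -> qspan s v.
Proof. by exists 1%N. Qed.

Lemma qspanD s v w : qspan s v -> qspan s w -> qspan s (v + w).
Proof.
move=> [m m0 sv] [n n0 sw]; exists (m * n)%N; first by rewrite muln_gt0 m0.
rewrite mulrnDl mulrnA [in X in _ + X]mulnC mulrnA.
by apply: zspanD; exact: zspanMn.
Qed.

Lemma qspanMz s v (a : int) : qspan s v -> qspan s (v *~ a).
Proof.
by move=> [m m0 sv]; exists m => //; rewrite -[_ *+ m]/(_ *~ Posz m) mulrzAC; exact: zspanMz.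
Qed.

Lemma qspan_div s v n : (0 < n)%N -> qspan s (v *+ n) -> qspan s v.
Proof.
by move=> n0 [m m0 sv]; exists (n * m)%N; rewrite ?muln_gt0 ?n0// mulrnA.
Qed.

Lemma zspan_sumP s v :
  zspan s v <-> exists e : nat -> int, v = \sum_(i < size s) s`_i *~ e i.
Proof.
elim: s v => [|u s IH] v /=.
  split=> [->|[e ->]]; last by rewrite big_ord0.
  by exists (fun=> 0); rewrite big_ord0.
split=> [[a /IH[e ve]]|[e ->]].
  exists (fun i => if i is j.+1 then e j else a).
  by rewrite big_ord_recl /= -[LHS](subrK (u *~ a)) ve addrC.
rewrite big_ord_recl; exists (e 0%N); rewrite addrC addKr; apply/IH.
by exists (fun i => e i.+1).
Qed.

Lemma zindepP s : zindep s -> forall e : nat -> int,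
  \sum_(i < size s) s`_i *~ e i = 0 -> forall i, (i < size s)%N -> e i = 0.
Proof.
elim: s => [//|u s IH] /= [si us] e; rewrite big_ord_recl /= => e0.
have u0 : e 0%N = 0.
  apply: us; move/eqP: e0; rewrite addr_eq0 => /eqP ->; apply: zspanN.
  by apply/zspan_sumP; exists (fun i => e i.+1).
move: e0; rewrite u0 mulr0z add0r => /(IH si (fun i => e i.+1)) e0 [//|i] si'.
exact: e0.
Qed.

(** Greedily: an element is kept exactly when none of its nonzero multiples lies
    in the span of the elements kept so far. *)
Lemma max_zindep (T : eqType) (f : T -> V) (L : seq T) :
  exists S : seq T, [/\ subseq S L, zindep (map f S)
    & forall v, zspan (map f L) v -> qspan (map f S) v].
Proof.
elim: L => [|x L [S [SL Si Sq]]]; first by exists [::]; split=> // v /zspan_qspan.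
have [[a [fxa a0]]|nx] := pselect (exists a : int, zspan (map f S) (f x *~ a) /\ a != 0).
  exists S; split=> //.
    by apply: subseq_trans SL _; exact: subseq_cons.
  have fx : qspan (map f S) (f x).
    by exists `|a|%N; [rewrite absz_gt0|exact: zspan_absz].
  move=> v [b /Sq vb]; rewrite -[v](subrK (f x *~ b)).
  by apply: qspanD => //; exact: qspanMz.
exists (x :: S); split=> /=.
- by rewrite eqxx.
- by split=> // a fxa; apply/eqP; apply/negP => /negP a0; apply: nx; exists a.
move=> v [b /Sq [m m0 vb]]; exists m => //=; exists (b * m%:Z).
by move: vb; rewrite mulrnBl mulrzA.
Qed.

Definition torsion v := exists2 m, (0 < m)%N & v *+ m = 0.

Lemma torsion0 : torsion 0.
Proof. by exists 1%N. Qed.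

Lemma torsionD v w : torsion v -> torsion w -> torsion (v + w).
Proof.
move=> [m m0 vm] [n n0 wn]; exists (m * n)%N; first by rewrite muln_gt0 m0.
by rewrite mulrnDl mulrnA vm mul0rn mulnC mulrnA wn mul0rn addr0.
Qed.

Lemma torsionN v : torsion v -> torsion (- v).
Proof. by move=> [m m0 vm]; exists m => //; rewrite mulNrn vm oppr0. Qed.

(** If a nonzero multiple [a u] of the head lies in the span of the tail, then the
    coefficient of [u] matters only modulo [a], and two torsion elements with the
    same residue differ by a torsion element of the span of the tail. Otherwise
    the coefficient of [u] in a torsion element vanishes. *)
Lemma torsion_finite s : exists L : seq V,
  forall v, zspan s v -> torsion v -> v \in L.
Proof.
elim: s => [|u s [L HL]]; first by exists [:: 0] => v -> _; rewrite mem_head.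
have [[a [a0 ua]]|nu] := pselect (exists a : int, a != 0 /\ zspan s (u *~ a)).
  pose P (r : 'I_`|a|) w := torsion w /\ zspan s (w - u *~ r%:Z).
  pose w r := if pselect (exists w, P r w) is left p then projT1 (cid p) else 0.
  exists [seq w r + l | r <- enum 'I_`|a|, l <- L] => v [b vb] tv.
  have rP : (`|(b %% a)%Z| < `|a|)%N.
    by rewrite -ltz_nat gez0_abs ?modz_ge0// abszE ltz_mod.
  pose r := Ordinal rP.
  have br : b = (b %/ a)%Z * a + r%:Z by rewrite /= gez0_abs ?modz_ge0// -divz_eq.
  have Pv : P r v.
    split=> //; have -> : v - u *~ r%:Z = v - u *~ b + u *~ a *~ (b %/ a)%Z.
      by rewrite {1}br mulrzDr opprD addrA mulrC mulrzA addrAC subrK.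
    by apply: zspanD => //; exact: zspanMz.
  have Pw : P r (w r).
    rewrite /w; case: pselect => [p|[]]; last by exists v.
    exact: projT2 (cid p).
  apply/allpairsP; exists (r, v - w r) => /=; split.
  - by rewrite mem_enum.
  - have [[tv' sv] [tw sw]] := (Pv, Pw); apply: HL; last exact: torsionD (torsionN _).
    by have := zspanB sv sw; rewrite opprB addrA subrK.
  - by rewrite addrC subrK.
exists L => v [b vb] [m m0 vm]; have b0 : b = 0.
  apply/eqP/negP => /negP b0; apply: nu; exists (b * m%:Z); split.
    by rewrite mulf_neq0// eqz_nat -lt0n.
  have := zspanN (zspanMn m vb); rewrite mulrnBl vm sub0r opprK.
  by rewrite mulrzA.
by apply: HL; [move: vb; rewrite b0 mulr0z subr0|exists m].
Qed.

(** With fewer vectors in [s] than in [x], the matrix of coefficients of the [x i]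
    over [s] has a nonzero left kernel over the rationals; clearing denominators
    yields an integral relation between the [x i]. *)
Lemma steinitz k (x : 'I_k -> V) s :
  (forall e : 'I_k -> int, \sum_i x i *~ e i = 0 -> forall i, e i = 0) ->
  (forall i, qspan s (x i)) -> (k <= size s)%N.
Proof.
move=> xi xs; rewrite leqNgt; apply/negP => lk.
have /choice[m mP] : forall i, exists m, (0 < m)%N /\ zspan s (x i *+ m).
  by move=> i; have [m m0 xm] := xs i; exists m.
have /choice[a aP] : forall i, exists a : nat -> int,
    x i *+ m i = \sum_(j < size s) s`_j *~ a j.
  by move=> i; apply/zspan_sumP; case: (mP i).
pose A := \matrix_(i < k, j < size s) (a i j)%:~R : 'M[rat]_(k, size s).
have : kermx A != 0.
  by rewrite -mxrank_eq0 mxrank_ker subn_eq0 -ltnNge (leq_ltn_trans (rank_leq_col A)).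
move=> /matrix0Pn[r [j Krj]].
pose u := row r (kermx A).
have uA : u *m A = 0 by rewrite -row_mul mulmx_ker row0.
(* [rat_poly_scale] clears the denominators of a polynomial, and [rVpoly] makes it
   applicable to a row. *)
have [q [c c0 uq]] := rat_poly_scale (rVpoly u).
have ue i : u 0 i = c%:~R^-1 * (q`_i)%:~R.
  by rewrite -coef_rVpoly_ord uq coefZ coef_map.
pose e i := q`_i.
have eA (j' : 'I_(size s)) : \sum_(i < k) e i * a i j' = 0.
  have /matrixP/(_ 0 j') := uA; rewrite !mxE.
  under eq_bigr do rewrite ue mxE -mulrA -intrM.
  rewrite -mulr_sumr -rmorph_sum /= => /eqP.
  by rewrite mulf_eq0 invr_eq0 !intr_eq0 (negbTE c0) /= => /eqP.
have : forall i : 'I_k, e i * (m i)%:Z = 0.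
  apply: (xi (fun i : 'I_k => e i * (m i)%:Z)).
  under eq_bigr => i _ do rewrite mulrC mulrzA -[_ *~ Posz _]/(_ *+ _) aP.
  under eq_bigr => i _ do rewrite mulrz_suml.
  rewrite exchange_big big1//= => j' _.
  under eq_bigr => i _ do rewrite -mulrzA mulrC.
  by rewrite -mulrz_sumr eA mulr0z.
move=> /(_ j)/eqP; rewrite mulf_eq0 eqz_nat gtn_eqF ?orbF; last by case: (mP j).
move=> /eqP ej; move: Krj; have : u 0 j = 0 by rewrite ue -/(e j) ej mulr0.
by rewrite mxE => ->; rewrite eqxx.
Qed.

Definition zgen k (x : 'I_k -> V) := forall v, exists e : 'I_k -> int, v = \sum_i x i *~ e i.
Definition zfree k (x : 'I_k -> V) :=
  forall e : 'I_k -> int, \sum_i x i *~ e i = 0 -> forall i, e i = 0.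

(** Adding [c] times the [i]-th generator to the [j]-th one leaves a linear
    combination unchanged if [c] times its [j]-th coefficient is subtracted from
    the [i]-th one. *)
Lemma transvection_sum k (x : 'I_k -> V) (i j : 'I_k) (c : int) (a : 'I_k -> int) :
  i != j ->
  \sum_l (if l == j then x j + x i *~ c else x l) *~ (if l == i then a i - c * a j else a l)
  = \sum_l x l *~ a l.
Proof.
move=> ij; rewrite (bigD1 i)//= (bigD1 j)/=; last by rewrite eq_sym.
rewrite [RHS](bigD1 i)//= [X in _ = _ + X](bigD1 j)/=; last by rewrite eq_sym.
rewrite !eqxx (negbTE ij) eq_sym (negbTE ij) !addrA; congr (_ + _).
  by rewrite mulrzDl mulrzBr mulrzA [x j *~ _ + _]addrC addrA subrK.
by apply: eq_bigr => l /andP[li lj]; rewrite (negbTE li) (negbTE lj).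
Qed.

(** A generating family of minimal size is free. Given a nontrivial relation,
    Euclid's algorithm on its coefficients, performed by transvections of the
    family, ends with a relation that has a single nonzero coefficient; as there
    is no torsion the corresponding generator vanishes, against minimality. *)
Lemma free_basis s : (forall v, zspan s v) ->
  (forall v m, (0 < m)%N -> v *+ m = 0 -> v = 0) ->
  exists k (x : 'I_k -> V), zgen x /\ zfree x.
Proof.
move=> gs tf; pose P k := `[< exists x : 'I_k -> V, zgen x >].
have exP : exists k, P k.
  exists (size s); apply/asboolP; exists (fun i => s`_i) => v.
  by have /zspan_sumP[e ->] := gs v; exists (fun i => e i).
case: (ex_minnP exP) => k /asboolP[x gx] min_k; exists k, x; split=> //.
move=> e; have [N] := ubnP (\sum_i `|e i|)%N.
elim: N x gx e => // N IH x gx e; rewrite ltnS => eN e0 i.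
apply/eqP/negP => /negP ei.
have [j /andP[ji ej]|ne] := pickP (fun j => (j != i) && (e j != 0)); last first.
  have xi : x i = 0.
    apply: (tf _ `|e i|%N); first by rewrite absz_gt0.
    have : x i *~ e i = 0.
      rewrite -[RHS]e0 (bigD1 i)//= big1 ?addr0// => j ji.
      by move: (ne j); rewrite ji /= => /negbFE/eqP ->; rewrite mulr0z.
    by case: (e i) => n //= /eqP; rewrite oppr_eq0 => /eqP.
  clear e eN e0 ei ne; case: k i x gx min_k xi {IH} => [[]//|k] i x gx min_k xi.
  have : P k.
    apply/asboolP; exists (x \o lift i) => v; have [e ->] := gx v.
    exists (e \o lift i); rewrite (bigD1_ord i)//= xi mul0rz add0r.
    by [].
  by move=> /min_k; rewrite ltnn.
wlog eij : i j ei ej ji / (`|e j| <= `|e i|)%N => [W|].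
  have [le|/ltnW le] := leqP `|e j|%N `|e i|%N; first exact: (W i j).
  by apply: (W j i) => //; rewrite eq_sym.
have ij : i != j by rewrite eq_sym.
(* With this sign the absolute value of the i-th coefficient drops by that of the
   j-th. *)
pose c : int := if (0 < e i) == (0 < e j) then 1 else -1.
have ce : (`|(e i - c * e j)%R| < `|e i|)%N by rewrite /c; case: ifP; lia.
pose x' l := if l == j then x j + x i *~ c else x l.
pose e' l := if l == i then e i - c * e j else e l.
have gx' : zgen x'.
  move=> v; have [a ->] := gx v.
  by exists (fun l => if l == i then a i - c * a j else a l); rewrite transvection_sum.
have : e' j = 0.
  apply: (IH x') => //; last by rewrite transvection_sum.
  apply: leq_trans eN; rewrite (bigD1 i)//= [leqRHS](bigD1 i)//= /e' eqxx -addSn leq_add//.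
  by apply: leq_sum => l /negbTE ->.
by rewrite /e' (negbTE ji) => /eqP; apply/negP.
Qed.

End IntegerSpan.

(** * The lower central series *)

Arguments lcs : simpl never.

Section Commutators.
Variable G : groupType.
Implicit Types (A B H K Y : set G) (x y z k : G).

Lemma commMg x y z : ([~ x * y, z] = [~ x, z] ^ y * [~ y, z])%g.
Proof. by rewrite /commg /conjg !gnorm. Qed.

Lemma commgM x y z : ([~ x, y * z] = [~ x, z] * [~ x, y] ^ z)%g.
Proof. by rewrite /commg /conjg !gnorm. Qed.

Lemma commVg x y : ([~ x^-1, y] = ([~ x, y]^-1) ^ x^-1)%g.
Proof. by rewrite /commg /conjg !gnorm. Qed.

Lemma commgV x y : ([~ x, y^-1] = ([~ x, y]^-1) ^ y^-1)%g.
Proof. by rewrite /commg /conjg !gnorm. Qed.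

Lemma hall_witt x y z :
  ([~ x, y^-1, z] ^ y * [~ y, z^-1, x] ^ z * [~ z, x^-1, y] ^ x = 1)%g.
Proof. by rewrite /commg /conjg !gnorm. Qed.

Lemma centralizing_left K B y : is_subgroup K -> is_subgroup B -> normalizes K B ->
  is_subgroup [set x | K x /\ B [~ x, y]%g].
Proof.
move=> sK sB nB; split=> [|x x' [Kx Bx] [Kx' Bx']|x [Kx Bx]] /=.
- by rewrite comm1g; split; exact: subg1.
- by rewrite commMg; split; apply: subgM => //; exact: nB.
- by rewrite commVg; split; [exact: subgV|apply: nB; exact: subgV].
Qed.

Lemma centralizing_right K B x : is_subgroup K -> is_subgroup B -> normalizes K B ->
  is_subgroup [set y | K y /\ B [~ x, y]%g].
Proof.
move=> sK sB nB; split=> [|y y' [Ky By] [Ky' By']|y [Ky By]] /=.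
- by rewrite commg1; split; exact: subg1.
- by rewrite commgM; split; apply: subgM => //; exact: nB.
- by rewrite commgV; split; [exact: subgV|apply: nB; exact: subgV].
Qed.

Lemma conj_preim_subgroup B g : is_subgroup B -> is_subgroup [set x | B (x ^ g)%g].
Proof.
move=> sB; split=> [|x y Bx By|x Bx] /=.
- by rewrite conj1g; exact: subg1.
- by rewrite conjMg; exact: subgM.
- by rewrite conjVg; exact: subgV.
Qed.

Section LowerCentralSeries.
Variable K : set G.
Hypothesis sK : is_subgroup K.

Lemma lcs_subgroup i : is_subgroup (lcs K i).
Proof. by case: i => [|i] //=; exact: generated_subgroup. Qed.
#[local] Hint Resolve lcs_subgroup : core.

Lemma lcs_comm i x k : lcs K i x -> K k -> lcs K i.+1 [~ x, k]%g.
Proof. by move=> ix Kk; apply: sub_generated; exists (x, k). Qed.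

Lemma lcs_sub i : lcs K i `<=` K.
Proof.
elim: i => [//|i IH]; apply: generated_sub => // _ [[x k] [/= ix Kk] <-].
by apply: subgR => //; exact: IH.
Qed.

Lemma lcs_normal_by i g : (forall x, K x -> K (x ^ g)%g) ->
  forall x, lcs K i x -> lcs K i (x ^ g)%g.
Proof.
move=> ng; elim: i => [//|i IH].
apply: generated_sub; first exact: (conj_preim_subgroup g (lcs_subgroup i.+1)).
by move=> _ [[x k] [/= ix Kk] <-] /=; rewrite conjRg; apply: lcs_comm; auto.
Qed.

Lemma lcs_normal i x k : K k -> lcs K i x -> lcs K i (x ^ k)%g.
Proof. by move=> Kk; apply: lcs_normal_by => y Ky; exact: subgJ. Qed.

Lemma lcsS i : lcs K i.+1 `<=` lcs K i.
Proof.
apply: generated_sub => // _ [[x k] [/= ix Kk] <-].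
rewrite commgEl; apply: subgM => //; [exact: subgV|exact: lcs_normal].
Qed.

Lemma lcs_le i j : (i <= j)%N -> lcs K j `<=` lcs K i.
Proof.
by move=> /subnK <-; elim: (j - i)%N => [//|n IH] x /lcsS; exact: IH.
Qed.

(** The lower central series is strongly central. By induction on [b], the
    Hall-Witt identity expresses [~ u, k, x] through commutators which involve
    [u] and [k] one at a time. *)
Lemma lcs_comm_lcs a b x y :
  lcs K a x -> lcs K b y -> lcs K (a + b).+1 [~ x, y]%g.
Proof.
elim: b a x y => [|b IH] a x y ax; first by rewrite addn0; exact: lcs_comm.
move=> /(_ [set y | K y /\ lcs K (a + b.+1).+1 [~ x, y]%g])[]//; split.
  by apply: centralizing_right => //; exact: lcs_normal.
move=> _ [[u k] [/= bu Kk] <-] /=; have Ku := lcs_sub bu; have Kx := lcs_sub ax.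
split; first exact: subgR.
rewrite -invgR; apply: (subgV (lcs_subgroup _)).
have := hall_witt x u k^-1; rewrite invgK.
have K' : K k^-1%g by exact: subgV.
(* The other two factors of the Hall-Witt identity. *)
have h1 : lcs K (a + b.+1).+1 ([~ x, u^-1, k^-1] ^ u)%g.
  apply: lcs_normal => //; rewrite addnS; apply: lcs_comm => //.
  by apply: IH => //; exact: subgV.
have h2 : lcs K (a + b.+1).+1 ([~ k^-1, x^-1, u] ^ x)%g.
  apply: lcs_normal => //; rewrite addnS -addSn; apply: IH => //.
  by rewrite -invgR; apply: (subgV (lcs_subgroup _)); apply: lcs_comm => //; exact: subgV.
move=> /eqP; rewrite -mulgA mulg_eq1 => /eqP E.
have : lcs K (a + b.+1).+1 ([~ u, k, x] ^ k^-1)%g.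
  by apply: (subgMr (lcs_subgroup _) h2); apply: (subgVE (lcs_subgroup _)); rewrite -E.
by move=> /(lcs_normal Kk); rewrite -conjgM mulVg conjg1.
Qed.

Lemma lcs_section i : abelian_section (lcs K i) (lcs K i.+1).
Proof.
split=> //; first exact: lcsS.
by move=> x y ix iy; apply: lcs_comm => //; exact: lcs_sub iy.
Qed.

Definition lcs_proj i : G -> quo (lcs K i) (lcs K i.+1) :=
  qproj (lcs K i) (lcs K i.+1).

Lemma lcs_projM i : additive_on (lcs K i) (lcs_proj i).
Proof. by move=> x y ix iy; apply: qprojM => //; exact: lcs_section. Qed.

Lemma lcs_proj_eq0 i x : lcs K i x -> lcs_proj i x = 0 <-> lcs K i.+1 x.
Proof. by move=> ix; apply: qproj_eq0 => //; exact: lcs_section. Qed.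

Lemma lcs_projS i x : lcs K i.+1 x -> lcs_proj i x = 0.
Proof. by move=> ix; apply/lcs_proj_eq0 => //; exact: lcsS. Qed.

Lemma lcs_projJ i x k : lcs K i x -> K k -> lcs_proj i (x ^ k)%g = lcs_proj i x.
Proof.
move=> ix Kk; rewrite -[(x ^ k)%g](mulVKg x) -/(commg x k) lcs_projM//.
  by rewrite (@lcs_projS _ [~ x, k]%g) ?addr0//; exact: lcs_comm.
by apply: lcsS; exact: lcs_comm.
Qed.

(** Commutation induces a bilinear map from gamma_i and K to
    gamma_(i+1) / gamma_(i+2). This is what makes exponents of commutators
    multiply, in both estimates of growth and in the torsion argument for the
    action on the lower central series. *)
Lemma comm_additive_left i k : K k ->
  additive_on (lcs K i) (fun x => lcs_proj i.+1 [~ x, k]%g).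
Proof.
move=> Kk x y ix iy; have Ky := lcs_sub iy.
have xk := lcs_comm ix Kk; have yk := lcs_comm iy Kk.
rewrite commMg lcs_projM//; last exact: (lcs_normal Ky xk).
by rewrite (lcs_projJ xk Ky).
Qed.

Lemma comm_additive_right i x : lcs K i x ->
  additive_on K (fun k => lcs_proj i.+1 [~ x, k]%g).
Proof.
move=> ix k l Kk Kl; have xk := lcs_comm ix Kk; have xl := lcs_comm ix Kl.
rewrite commgM lcs_projM//; last exact: (lcs_normal Kl xk).
by rewrite (lcs_projJ xk Kl) addrC.
Qed.

End LowerCentralSeries.

Lemma lcs_subset H K i : H `<=` K -> lcs H i `<=` lcs K i.
Proof.
move=> HK; elim: i => [//|i IH]; apply: generated_sub; first exact: generated_subgroup.
by move=> _ [[x k] [/= ix Hk] <-]; apply: sub_generated; exists (x, k) => //; split; [exact: IH|exact: HK].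
Qed.

Definition symm Y : set G := [set y | Y y \/ Y y^-1%g].

(** Left-normed commutators [y_0, ..., y_i] of generators and their inverses;
    the index is the weight minus one, as for [lcs]. *)
Fixpoint lcomm Y i : set G :=
  if i is j.+1 then [set [~ p.1, p.2]%g | p in lcomm Y j `*` symm Y] else symm Y.

Lemma finite_symm Y : finite_set Y -> finite_set (symm Y).
Proof.
move=> fY; apply: (@sub_finite_set _ _ (Y `|` [set y^-1%g | y in Y])).
  by move=> y [Yy|Yy]; [left|right; exists y^-1%g; rewrite ?invgK].
by rewrite finite_setU; split=> //; exact: finite_image.
Qed.

Lemma finite_lcomm Y i : finite_set Y -> finite_set (lcomm Y i).
Proof.
move=> fY; elim: i => [|i IH] /=; first exact: finite_symm.
by apply: finite_image; apply: finite_setX => //; exact: finite_symm.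
Qed.

Lemma symm_generated Y : symm Y `<=` generated Y.
Proof.
by move=> y [/sub_generated//|/sub_generated]; apply: subgVE; exact: generated_subgroup.
Qed.

Lemma lcomm_lcs Y i : lcomm Y i `<=` lcs (generated Y) i.
Proof.
elim: i => [|i IH] /=; first exact: symm_generated.
move=> _ [[x k] [/= ix Yk] <-]; apply: sub_generated; exists (x, k) => //; split=> /=.
  exact: IH.
exact: symm_generated.
Qed.

(** All larger weights are included because [l ^ y = l * [~ l, y]] then shows at
    once that this subgroup is normal. *)
Definition lcomm_tail Y v : set G :=
  generated [set x | exists2 w, (v <= w)%N & lcomm Y w x].

Lemma lcomm_tail_normal Y v : normalizes (generated Y) (lcomm_tail Y v).
Proof.
have sT := generated_subgroup [set x | exists2 w, (v <= w)%N & lcomm Y w x].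
have nY y : symm Y y -> forall x, lcomm_tail Y v x -> lcomm_tail Y v (x ^ y)%g.
  move=> Yy; apply: generated_sub; first exact: (conj_preim_subgroup y sT).
  move=> z [w vw wz] /=; rewrite -[(z ^ y)%g](mulVKg z) -/(commg z y).
  apply: (subgM sT); apply: sub_generated; first by exists w.
  by exists w.+1; [exact: leqW|exists (z, y)].
move=> x k gk; move: k gk x.
pose P := [set k | forall x, lcomm_tail Y v x ->
  lcomm_tail Y v (x ^ k)%g /\ lcomm_tail Y v (x ^ k^-1)%g].
suff: generated Y `<=` P by move=> YP k /YP Pk x /Pk[].
apply: generated_sub.
  split=> [x Tx|k l Pk Pl x Tx|k Pk x /Pk[]] /=.
  - by rewrite invg1 conjg1.
  - rewrite invgM !conjgM; split; first by apply: (proj1 (Pl _ _)); case: (Pk x Tx).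
    by apply: (proj2 (Pk _ _)); case: (Pl x Tx).
  - by rewrite invgK.
move=> y Yy x Tx; split; apply: nY => //; first by left.
by right; rewrite invgK.
Qed.

Lemma lcomm_tail_comm Y v x k : lcomm_tail Y v x -> generated Y k ->
  lcomm_tail Y v.+1 [~ x, k]%g.
Proof.
have sK := generated_subgroup Y.
have sT i : is_subgroup (lcomm_tail Y i) by exact: generated_subgroup.
move=> Tx; have yP y : symm Y y -> lcomm_tail Y v.+1 [~ x, y]%g.
  move=> Yy; case: (Tx [set x | generated Y x /\ lcomm_tail Y v.+1 [~ x, y]%g]) => //.
  split; first by apply: centralizing_left => //; exact: lcomm_tail_normal.
  move=> z [w vw wz] /=; split.
    by apply: lcs_sub => //; exact: lcomm_lcs wz.
  by apply: sub_generated; exists w.+1 => //; exists (z, y).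
move=> /(_ [set k | generated Y k /\ lcomm_tail Y v.+1 [~ x, k]%g])[]//.
split; first by apply: centralizing_right => //; exact: lcomm_tail_normal.
by move=> y Yy; split; [exact: sub_generated|apply: yP; left].
Qed.

Lemma lcs_lcomm_tail Y v : lcs (generated Y) v `<=` lcomm_tail Y v.
Proof.
have sT i : is_subgroup (lcomm_tail Y i) by exact: generated_subgroup.
elim: v => [|v IH] /=.
  apply: generated_sub => // y Yy; apply: sub_generated; exists 0%N => //.
  by left.
apply: generated_sub => // _ [[x k] [/= vx gk] <-].
by apply: lcomm_tail_comm => //; exact: IH.
Qed.

(** Every element of [lcs] is a product of left-normed commutators of at least the
    same weight, by [lcs_lcomm_tail], and those of larger weight vanish in the
    quotient. *)
Lemma lcs_proj_span Y v (L : seq G) : (forall x, lcomm Y v x -> x \in L) ->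
  forall x, lcs (generated Y) v x ->
    zspan (map (lcs_proj (generated Y) v) L) (lcs_proj (generated Y) v x).
Proof.
move=> YL x; have sK := generated_subgroup Y; set K := generated Y in sK *.
have sv i := lcs_subgroup sK i.
move=> /lcs_lcomm_tail /(_ [set x | lcs K v x /\
  zspan (map (lcs_proj K v) L) (lcs_proj K v x)])[]//; split.
  have pM : additive_on (lcs K v) (lcs_proj K v) by exact: lcs_projM.
  split=> [|y z [vy sy] [vz sz]|y [vy sy]] /=; split; do ?[exact: subg1|exact: subgM|exact: subgV].
  - by rewrite (additive_on1 (sv v) pM); exact: zspan0.
  - by rewrite pM//; exact: zspanD.
  - by rewrite (additive_onV (sv v) pM)//; exact: zspanN.
move=> z [w vw wz] /=; have lz := lcomm_lcs wz.
split; first by apply: lcs_le lz.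
move: vw; rewrite leq_eqVlt => /predU1P[vw|vw].
  by apply: zspan_mem; apply: map_f; apply: YL; rewrite vw.
by rewrite lcs_projS//; [exact: zspan0|apply: lcs_le lz].
Qed.

Definition level_basis Y v (S : seq G) :=
  [/\ forall x, x \in S -> lcomm Y v x,
      zindep (map (lcs_proj (generated Y) v) S)
    & forall x, lcs (generated Y) v x ->
      qspan (map (lcs_proj (generated Y) v) S) (lcs_proj (generated Y) v x)].

Lemma level_basis_exists Y v : finite_set Y -> exists S, level_basis Y v S.
Proof.
move=> fY; have /finite_seqP[L EL] := finite_lcomm v fY.
have [S [SL Si Sq]] := max_zindep (lcs_proj (generated Y) v) L.
exists S; split=> //.
  by move=> x /(mem_subseq SL) xL; rewrite EL.
by move=> x vx; apply: Sq; apply: lcs_proj_span vx => y; rewrite EL.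
Qed.

End Commutators.

(** * Collection: the upper bound for growth *)

Section Collection.
Variables (R : realType) (G : groupType) (Y : set G).
Implicit Types (x y z e : G) (s t : seq (nat * G)) (l : nat * G) (v w n : nat).
Let K := generated Y.

(** Weighted letters: all iterated commutators of generators, with any bracketing.
    Collection only ever creates letters of this kind, and there are finitely many
    of them in each weight. *)
Inductive letter : nat -> G -> Prop :=
| letter_gen y : symm Y y -> letter 1 y
| letter_comm a b x y : letter a x -> letter b y -> letter (a + b) [~ x, y]%g.

Lemma letter_gt0 w x : letter w x -> (0 < w)%N.
Proof. by elim=> // a b *; rewrite addn_gt0; apply/orP; left. Qed.

Lemma letterV w x : letter w x -> letter w x^-1%g.
Proof.
case=> [y [Yy|Yy]|a b y z ay bz]; last by rewrite invgR addnC; exact: letter_comm.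
  by apply: letter_gen; right; rewrite invgK.
by apply: letter_gen; left.
Qed.

Lemma letter_lcs w x : letter w x -> lcs K w.-1 x.
Proof.
elim=> [y /symm_generated//|a b y z ay ly bz lz].
have -> : (a + b).-1 = (a.-1 + b.-1).+1.
  by move: (letter_gt0 ay) (letter_gt0 bz); lia.
by apply: lcs_comm_lcs => //; exact: generated_subgroup.
Qed.

Lemma lcomm_letter i x : lcomm Y i x -> letter i.+1 x.
Proof.
elim: i x => [|i IH] x /=; first exact: letter_gen.
move=> [[y k] [/= iy Yk] <-]; rewrite -addn1.
by apply: letter_comm; [exact: IH|exact: letter_gen].
Qed.

Lemma finite_letter w : finite_set Y -> finite_set (letter w).
Proof.
move=> fY; have [N] := ubnP w; elim: N w => // N IH w; rewrite ltnS => wN.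
pose F a := [set [~ p.1, p.2]%g | p in
  (if (0 < a)%N then letter a `*` letter (w - a)%N else set0)].
apply: (@sub_finite_set _ _ (symm Y `|` \bigcup_(a in `I_w) F a)).
  suff inv w' x : letter w' x -> w' = w -> (symm Y `|` \bigcup_(a in `I_w) F a) x.
    by move=> x /inv; apply.
  case=> [y|a b y z ay bz]; first by left.
  have [a0 b0] := (letter_gt0 ay, letter_gt0 bz) => abw.
  right; exists a; first by rewrite /=; lia.
  exists (y, z) => //; rewrite a0; split => //=.
  by have -> : (w - a = b)%N by lia.
rewrite finite_setU; split; first exact: finite_symm.
apply: bigcup_finite => // a /= aw; apply: finite_image.
case: ifP => // a0; apply: finite_setX; apply: IH; lia.
Qed.

Definition weval s : G := (\prod_(l <- s) l.2)%g.
(** A word should count as bounded at scale [n] when it has O(n^w) letters of each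
    weight [w]. This sum encodes all these conditions at once and, unlike them, it
    evolves multiplicatively under collection: moving a letter of weight [v] across
    a word multiplies it by at most [1 + n ^ (- v)]. *)
Definition wnorm n s : R := \sum_(l <- s) n%:R^-1 ^+ l.1.

Lemma weval_nil : weval [::] = 1%g.
Proof. by rewrite /weval big_nil. Qed.
Lemma wnorm_nil n : wnorm n [::] = 0.
Proof. by rewrite /wnorm big_nil. Qed.
Lemma weval_cons l s : weval (l :: s) = (l.2 * weval s)%g.
Proof. by rewrite /weval big_cons. Qed.
Lemma weval1 l : weval [:: l] = l.2.
Proof. by rewrite /weval big_seq1. Qed.
Lemma wnorm1 n l : wnorm n [:: l] = n%:R^-1 ^+ l.1.
Proof. by rewrite /wnorm big_seq1. Qed.
Lemma weval_cat s t : weval (s ++ t) = (weval s * weval t)%g.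
Proof. by rewrite /weval big_cat. Qed.
Lemma wnorm_cons n l s : wnorm n (l :: s) = n%:R^-1 ^+ l.1 + wnorm n s.
Proof. by rewrite /wnorm big_cons. Qed.
Lemma wnorm_cat n s t : wnorm n (s ++ t) = wnorm n s + wnorm n t.
Proof. by rewrite /wnorm big_cat. Qed.
Lemma wnorm_ge0 n s : 0 <= wnorm n s.
Proof. by apply: sumr_ge0 => l _; rewrite exprn_ge0// invr_ge0. Qed.

(** The state of the collection process in weight [v]: no letter lighter than [v]
    is left, and the letters of weight [v] still to be collected are in [E]. *)
Definition allowed v (E : seq G) s := forall l, l \in s ->
  [/\ letter l.1 l.2, (v <= l.1)%N & l.1 = v -> l.2 \in E \/ l.2^-1%g \in E].

Lemma allowed_cat v E s t : allowed v E s -> allowed v E t -> allowed v E (s ++ t).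
Proof. by move=> As At l; rewrite mem_cat => /orP[/As|/At]. Qed.

Lemma allowed_cons v E l s : allowed v E (l :: s) ->
  [/\ letter l.1 l.2, (v <= l.1)%N, l.1 = v -> l.2 \in E \/ l.2^-1%g \in E & allowed v E s].
Proof.
move=> As; have [? ? ?] := As l (mem_head _ _).
by split=> // l' ls; apply: As; rewrite inE ls orbT.
Qed.

Lemma word_inv v E s : allowed v E s -> exists t,
  [/\ allowed v E t, weval t = (weval s)^-1%g & forall n, wnorm n t = wnorm n s].
Proof.
elim: s => [|l s IH].
  by exists [::]; split=> //; rewrite weval_nil invg1.
move=> /allowed_cons[ll vl El /IH[t [At et nt]]].
exists (t ++ [:: (l.1, l.2^-1%g)]); split.
- apply: allowed_cat => // l'; rewrite inE => /eqP -> /=; split=> //; first exact: letterV.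
  by move=> /El[]; [right; rewrite invgK|left].
- by rewrite weval_cat et !weval_cons weval_nil mulg1 invgM.
- by move=> n; rewrite wnorm_cat nt !wnorm_cons wnorm_nil addr0 addrC.
Qed.

Lemma word_pow v E s q : allowed v E s -> exists t,
  [/\ allowed v E t, weval t = (weval s ^+ q)%g & forall n, wnorm n t = wnorm n s *+ q].
Proof.
move=> As; elim: q => [|q [t [At et nt]]].
  by exists [::]; split=> // *; rewrite ?weval_nil ?wnorm_nil.
exists (s ++ t); split; first exact: allowed_cat.
  by rewrite weval_cat et expgS.
by move=> n; rewrite wnorm_cat nt mulrS.
Qed.

(** Since [l ^ e = l * [~ l, e]], conjugation by [e] adds one letter of weight
    [w + v] for each letter of weight [w]. *)
Lemma word_conj v e s : letter v e -> (forall l, l \in s -> letter l.1 l.2) ->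
  exists t, [/\ forall l, l \in t -> letter l.1 l.2 /\ (l \in s \/ (v < l.1)%N),
    weval t = (weval s ^ e)%g
    & forall n, wnorm n t = wnorm n s * (1 + n%:R^-1 ^+ v)].
Proof.
move=> ve; elim: s => [|l s IH] ls.
  by exists [::]; split=> // *; rewrite ?weval_nil ?wnorm_nil ?conj1g ?mul0r.
have [|t [At et nt]] := IH; first by move=> l' l's; apply: ls; rewrite inE l's orbT.
have ll := ls l (mem_head _ _).
exists [:: l, (l.1 + v, [~ l.2, e]%g)%N & t]; split.
- move=> l'; rewrite !inE => /or3P[/eqP->|/eqP->|/At[? []]] /=.
  + by split=> //; left; rewrite eqxx.
  + by split; [exact: letter_comm|right; move: (letter_gt0 ll); lia].
  + by split=> //; left; apply/orP; right.
  + by split=> //; right.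
- by rewrite !weval_cons et /= mulgA /commg mulVKg conjMg.
- by move=> n; rewrite !wnorm_cons nt /= exprD; ring.
Qed.

Lemma word_conjX v e s a : letter v e -> (forall l, l \in s -> letter l.1 l.2) ->
  exists t, [/\ forall l, l \in t -> letter l.1 l.2 /\ (l \in s \/ (v < l.1)%N),
    weval t = (weval s ^ (e ^+ a))%g
    & forall n, wnorm n t = wnorm n s * (1 + n%:R^-1 ^+ v) ^+ a].
Proof.
move=> ve ls; elim: a => [|a [t [At et nt]]].
  exists s; split=> [l sl|| n]; last by rewrite mulr1.
  - by split; [exact: ls|left].
  - by rewrite expg0 conjg1.
have [|t' [At' et' nt']] := word_conj ve (s := t); first by move=> l /At[].
exists t'; split.
- move=> l /At'[ll]; split=> //; have [/At[]//|] := b; by right.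
- by rewrite et' et -conjgM expgSr.
- by move=> n; rewrite nt' nt exprSr mulrA.
Qed.

Lemma expgz_abs e a : exists2 e', e' = e \/ e' = e^-1%g & expgz e a = (e' ^+ `|a|%N)%g.
Proof.
case: a => n; first by exists e; [left|].
by exists e^-1%g; [right|rewrite /= expVgn].
Qed.

Lemma mulg_expgz e a : (e * expgz e a = expgz e (1 + a))%g.
Proof.
case: a => [n|[|n]].
- by rewrite /= -expgS.
- by rewrite /= expg1 mulgV.
- have -> : 1 + Negz n.+1 = Negz n by lia.
  by rewrite /expgz (expgSr _ n.+1) invgM mulVKg.
Qed.

Lemma mulVg_expgz e a : (e^-1 * expgz e a = expgz e (a - 1))%g.
Proof.
have {1}-> : a = 1 + (a - 1) by rewrite addrC subrK.
by rewrite -mulg_expgz mulKg.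
Qed.

(** All occurrences of [e] and its inverse are moved to the left end. A letter is
    crossed by at most as many of them as there are letters of weight [v], and the
    new letters that this creates are heavier than [v]. *)
Lemma collect v e E s : letter v e -> allowed v (e :: E) s -> exists a t,
  [/\ allowed v E t, weval s = (expgz e a * weval t)%g,
      (`|a| <= count (fun l => l.1 == v) s)%N
    & forall n, wnorm n t <= wnorm n s * (1 + n%:R^-1 ^+ v) ^+ count (fun l => l.1 == v) s].
Proof.
move=> ve; elim: s => [|l s IH].
  by exists 0, [::]; split=> // *; rewrite ?weval_nil ?wnorm_nil /= ?mulg1 ?mul0r.
move=> /allowed_cons[ll vl El /IH[a [t [At et ca nt]]]] /=.
have q0 n : 1 <= 1 + n%:R^-1 ^+ v :> R by rewrite lerDl exprn_ge0// invr_ge0.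
have nt' n (b : bool) : wnorm n t <= (n%:R^-1 ^+ l.1 + wnorm n s) *
    (1 + n%:R^-1 ^+ v) ^+ (b + count (fun l => l.1 == v) s).
  apply: le_trans (nt n) _; apply: ler_pM.
  - exact: wnorm_ge0.
  - by apply: exprn_ge0; exact: le_trans (q0 n).
  - by rewrite lerDr exprn_ge0// invr_ge0.
  - by rewrite ler_weXn2l// leq_addl.
have [/andP[/eqP lv /eqP le]|nle] := boolP ((l.1 == v) && (l.2 == e)).
  exists (1 + a), t; split=> //; last by move=> n; rewrite wnorm_cons.
    by rewrite weval_cons le et mulgA mulg_expgz.
  by rewrite lv eqxx; lia.
have [/andP[/eqP lv /eqP le]|nle'] := boolP ((l.1 == v) && (l.2 == e^-1%g)).
  exists (a - 1), t; split=> //; last by move=> n; rewrite wnorm_cons.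
    by rewrite weval_cons le et mulgA mulVg_expgz.
  by rewrite lv eqxx; lia.
have [e' ee' ea] := expgz_abs e a.
have ve' : letter v e' by case: ee' => ->; [|exact: letterV].
have [|u [Au eu nu]] := @word_conjX v e' [:: l] `|a|%N ve'.
  by move=> l'; rewrite inE => /eqP->.
exists a, (u ++ t); split.
- apply: allowed_cat => // l' /Au[ll' []]; last first.
    by move=> vl'; split=> //; [exact: ltnW|move=> l'v; rewrite l'v ltnn in vl'].
  rewrite inE => /eqP l'l; rewrite l'l; split=> // lv.
  move: nle nle'; rewrite lv eqxx /= => nle nle'.
  have [] := El lv; rewrite inE => /predU1P[le|]; do ?by [left|right].
    by rewrite le eqxx in nle.
  by rewrite -le invgK eqxx in nle'.
- rewrite weval_cat eu weval_cons et weval1 -ea conjgE.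
  by rewrite !mulgA mulgV mul1g.
- by apply: leq_trans ca _; rewrite leq_addl.
- move=> n; rewrite wnorm_cat nu wnorm1 wnorm_cons mulrDl.
  apply: lerD; last first.
    apply: le_trans (nt n) _; rewrite ler_wpM2l ?wnorm_ge0//.
    by rewrite ler_weXn2l// leq_addl.
  rewrite ler_wpM2l ?exprn_ge0 ?invr_ge0// ler_weXn2l//.
  by apply: leq_trans ca _; rewrite leq_addl.
Qed.

Lemma count_wnorm v n s : (0 < n)%N ->
  (count (fun l => l.1 == v) s)%:R * n%:R^-1 ^+ v <= wnorm n s.
Proof.
move=> n0; elim: s => [|l s IH] /=; first by rewrite mul0r wnorm_nil.
rewrite wnorm_cons natrD mulrDl lerD//; case: eqP => [->|_]; first by rewrite mul1r.
by rewrite mul0r exprn_ge0// invr_ge0.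
Qed.

(** A word of norm at most [A] has at most [A n ^ v] letters of weight [v], so
    collecting multiplies the norm by at most
    [(1 + n ^ (- v)) ^ (A n ^ v) <= exp A], uniformly in [n]. *)
Lemma collect_bound v e E A : letter v e -> exists A' : nat,
  forall n s, (0 < n)%N -> allowed v (e :: E) s -> wnorm n s <= A%:R ->
  exists a t, [/\ allowed v E t, weval s = (expgz e a * weval t)%g,
     (`|a| <= A * n ^ v)%N & wnorm n t <= A'%:R].
Proof.
move=> ve; exists (Num.truncn (A%:R * expR A%:R : R)).+1 => n s n0 As nA.
have [a [t [At et ca nt]]] := collect ve As; exists a, t; split=> //.
  apply: leq_trans ca _; rewrite -(ler_nat R) natrM natrX -ler_pdivrMr; last first.
    by rewrite exprn_gt0// ltr0n.
  by rewrite -exprVn; exact: le_trans (count_wnorm v s n0) nA.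
apply: (le_trans (nt n)); apply/ltW/(le_lt_trans _ (truncnS_gt _)).
have q0 : 0 <= n%:R^-1 ^+ v :> R by rewrite exprn_ge0// invr_ge0.
apply: ler_pM => //; first exact: wnorm_ge0.
apply: le_trans (_ : expR (n%:R^-1 ^+ v) ^+ _ <= _).
  apply: lerXn2r; rewrite ?nnegrE ?expR_ge0 ?addr_ge0//.
  exact: expR_ge1Dx.
rewrite -expRM_natl ler_expR mulr_natl -mulr_natl.
exact: le_trans (count_wnorm v s n0) nA.
Qed.


(** The words in [Q] of bounded norm at scale [n] take O(n ^ D) values. *)
Definition covers (Q : seq (nat * G) -> Prop) (D : nat) :=
  forall A : nat, exists B : nat, forall n, (0 < n)%N ->
    exists2 L : seq G, (size L <= B * n ^ D)%N &
      forall s, Q s -> wnorm n s <= A%:R -> weval s \in L.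

Lemma covers_sub (Q Q' : seq (nat * G) -> Prop) D :
  (forall s, Q s -> Q' s) -> covers Q' D -> covers Q D.
Proof.
move=> QQ' cQ A; have [B HB] := cQ A; exists B => n n0.
by have [L sL HL] := HB n n0; exists L => // s /QQ'; exact: HL.
Qed.

Definition int_range (N : nat) : seq int := [seq i%:Z - N%:Z | i <- iota 0 (2 * N).+1].

Lemma size_int_range N : size (int_range N) = (2 * N).+1.
Proof. by rewrite size_map size_iota. Qed.

Lemma mem_int_range N (a : int) : (`|a| <= N)%N -> a \in int_range N.
Proof.
move=> aN; apply/mapP; exists `|(a + N%:Z)%R|%N; last by lia.
by rewrite mem_iota; lia.
Qed.

(** The exponent of a collected letter of weight [v] has O(n ^ v) values. *)
Lemma covers_basis v e E D : letter v e ->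
  covers (allowed v E) D -> covers (allowed v (e :: E)) (v + D).
Proof.
move=> ve cE A; have [A' HA] := collect_bound E A ve; have [B HB] := cE A'.
exists ((2 * A + 1) * B)%N => n n0; have [L sL HL] := HB n n0.
exists [seq (expgz e a * x)%g | a <- int_range (A * n ^ v), x <- L].
  rewrite size_allpairs size_int_range expnD.
  apply: leq_trans (_ : ((2 * A + 1) * n ^ v) * (B * n ^ D) <= _)%N.
    apply: leq_mul => //; have : (0 < n ^ v)%N by rewrite expn_gt0 n0.
    by nia.
  by rewrite mulnACA.
move=> s Qs sA; have [a [t [At -> ca nt]]] := HA n s n0 Qs sA.
apply/allpairsP; exists (a, weval t); split=> //; first exact: mem_int_range.
exact: HL.
Qed.

Lemma letter_wnorm n v E t : (0 < n)%N -> allowed v E t ->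
  wnorm n t <= (size t)%:R * n%:R^-1 ^+ v.
Proof.
move=> n0; elim: t => [|l t IH]; first by rewrite wnorm_nil mul0r.
move=> /allowed_cons[_ vl _ /IH nt]; rewrite wnorm_cons /= -natr1 mulrDl mul1r addrC.
apply: lerD => //; apply: ler_wiXn2l => //.
by rewrite invf_le1 ?ler1n// ltr0n.
Qed.

(** If a power [e ^ M] is a word in the letters still allowed, then collecting [e]
    costs no power of [n]: its exponent is reduced modulo [M], and the O(n ^ v)
    copies of [t] which replace the multiples of [M] have bounded norm. *)
Lemma covers_torsion v e E D M t : letter v e -> (0 < M)%N -> allowed v E t ->
  (e ^+ M)%g = weval t -> covers (allowed v E) D -> covers (allowed v (e :: E)) D.
Proof.
move=> ve M0 At et cE A; have [A' HA] := collect_bound E A ve.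
have [B HB] := cE (A * size t + A')%N; exists (2 * M * B)%N => n n0.
have [L sL HL] := HB n n0.
exists [seq (r * x)%g | r <- [seq (e ^+ i)%g | i <- iota 0 M] ++
   [seq (e^-1 ^+ i)%g | i <- iota 0 M], x <- L].
  rewrite size_allpairs size_cat !size_map size_iota addnn -mul2n -[leqRHS]mulnA.
  by rewrite leq_mul2l sL orbT.
move=> s Qs sA; have [a [s' [As' -> ca ns']]] := HA n s n0 Qs sA.
have [t' [At' et' nt']] := word_inv At.
have [e' ee' ->] := expgz_abs e a; set a' := `|a|%N in ca *.
have [u [Au eu nu]] : exists u, [/\ allowed v E u, (e' ^+ M)%g = weval u
    & forall n, wnorm n u = wnorm n t].
  case: ee' => ->; first by exists t.
  by exists t'; split=> //; rewrite et' -et expVgn.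
have [u' [Au' eu' nu']] := word_pow (a' %/ M)%N Au.
apply/allpairsP; exists ((e' ^+ (a' %% M))%g, weval (u' ++ s')); split.
- have aM : (a' %% M)%N \in iota 0 M by rewrite mem_iota ltn_mod.
  by rewrite mem_cat; case: ee' => ->; apply/orP; [left|right]; exact: map_f.
- apply: HL; first exact: allowed_cat.
  rewrite wnorm_cat natrD lerD// nu' nu -[leLHS]mulr_natl.
  have nt := letter_wnorm n0 At.
  have q0 : 0 < n%:R ^+ v :> R by rewrite exprn_gt0// ltr0n.
  apply: (le_trans (ler_wpM2l (ler0n R (a' %/ M)) nt)).
  rewrite mulrCA natrM mulrC ler_wpM2r// exprVn ler_pdivrMr// -natrX -natrM ler_nat.
  by apply: leq_trans ca; exact: leq_div.
- rewrite weval_cat eu' -eu mulgA /=; congr (_ * _)%g.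
  by rewrite -expgnA -expgnDr addnC mulnC -divn_eq.
Qed.

Definition heavy v s := forall l, l \in s -> letter l.1 l.2 /\ (v <= l.1)%N.

(** The letters outside [S] are collected before those of [S], since eliminating
    them produces letters of [S]. *)
Lemma covers_level v (S : seq G) D : finite_set Y ->
  (forall e, e \in S -> letter v e) ->
  (forall e, letter v e -> exists M t,
     [/\ (0 < M)%N, allowed v S t & (e ^+ M)%g = weval t]) ->
  covers (heavy v.+1) D -> covers (heavy v) (v * size S + D).
Proof.
move=> fY Sv tor cD.
have cS : forall S', (forall e, e \in S' -> letter v e) ->
    covers (allowed v S') (v * size S' + D).
  elim=> [_|e S' IH Sv'] /=.
    rewrite muln0; apply: covers_sub cD => s As l /As[ll vl lv]; split=> //.
    by rewrite ltn_neqAle vl andbT; apply/eqP => /esym/lv[].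
  rewrite mulnS -addnA; apply: covers_basis; first by apply: Sv'; rewrite mem_head.
  by apply: IH => e' e'S; apply: Sv'; rewrite inE e'S orbT.
have /finite_seqP[L EL] := finite_letter v fY.
apply: (@covers_sub _ (allowed v (L ++ S))).
  move=> s hs l /hs[ll vl]; split=> // lv; left.
  have : l.2 \in L by have : letter v l.2 by [rewrite -lv]; rewrite EL.
  by rewrite mem_cat => ->.
have : forall e, e \in L -> letter v e by move=> e eL; rewrite EL.
elim: L {EL} => [|e L IH] Lv; first exact: cS.
have [M [t [M0 At et]]] := tor e (Lv e (mem_head _ _)).
apply: (covers_torsion _ M0 _ et); first exact: (Lv e (mem_head _ _)).
  move=> l /At[ll vl lv]; split=> // /lv[lS|lS]; [left|right];
  by rewrite mem_cat lS orbT.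
by apply: IH => e' e'L; apply: Lv; rewrite inE e'L orbT.
Qed.

Lemma heavy_word v x : lcs K v x -> exists2 s, heavy v.+1 s & weval s = x.
Proof.
move=> /lcs_lcomm_tail/generated_word_ball[m [w [_ wX] <-]].
elim: w wX => [|y w IH] wX; first by exists [::]; rewrite ?weval_nil ?big_nil.
have [|s hs es] := IH; first by move=> z zw; apply: wX; rewrite inE zw orbT.
have [w' vw yw] : exists2 w', (v <= w')%N & letter w'.+1 y.
  have [[w' vw]|[w' vw]] := wX y (mem_head _ _); first by move=> /lcomm_letter; exists w'.
  by move=> /lcomm_letter/letterV; rewrite invgK; exists w'.
exists ((w'.+1, y) :: s); last by rewrite weval_cons es big_cons.
by move=> l; rewrite inE => /predU1P[->|/hs].
Qed.

(** Modulo the next term of the lower central series, [x] is a product of powers of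
    [S]; the correction is a word in heavier letters. *)
Lemma zspan_word v (S : seq G) x : (forall e, e \in S -> letter v.+1 e) ->
  lcs K v x -> zspan (map (lcs_proj K v) S) (lcs_proj K v x) ->
  exists2 t, allowed v.+1 S t & weval t = x.
Proof.
have sK : is_subgroup K by exact: generated_subgroup.
have sv := lcs_subgroup sK v; have pM : additive_on (lcs K v) (lcs_proj K v) by exact: lcs_projM.
elim: S x => [|e S IH] x Sv vx /=.
  move=> /lcs_proj_eq0-/(_ sK vx)/heavy_word[t ht tx]; exists t => // l /ht[ll vl].
  split=> //; first exact: ltnW.
  by move=> lv; rewrite lv ltnn in vl.
have Se : letter v.+1 e by apply: Sv; rewrite mem_head.
have ve : lcs K v e := letter_lcs Se.
move=> [a]; rewrite -(additive_onZ sv pM a ve) -(additive_onV sv pM (subgZ a sv ve)) addrC.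
have vV := subgV sv (subgZ a sv ve).
rewrite -pM// => /IH[||t At tx].
- by move=> e' e'S; apply: Sv; rewrite inE e'S orbT.
- exact: subgM.
have At' : allowed v.+1 (e :: S) t.
  by move=> l /At[ll vl El]; split=> // /El[lS|lS]; [left|right]; rewrite inE lS orbT.
have [e' ee' ea] := expgz_abs e a.
have Ae : allowed v.+1 (e :: S) [:: (v.+1, e')].
  move=> l; rewrite inE => /eqP -> /=; split=> //.
    by case: ee' => ->; [|exact: letterV].
  by case: ee' => -> _; [left|right]; rewrite ?invgK mem_head.
have [u [Au eu _]] := word_pow `|a|%N Ae.
exists (u ++ t); first exact: allowed_cat.
by rewrite weval_cat eu tx weval1 /= -ea mulVKg.
Qed.

(** Collection in weights 1, ..., c: in each weight the level basis contributes the
    exponent [v.+1 * size (S v)], and the letters outside of it contribute nothing.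
    The remaining heavy words take their values in the finite group [lcs K c]. *)
Theorem growth_upper_bound c (S : nat -> seq G) : finite_set Y ->
  (forall v, level_basis Y v (S v)) -> finite_set (lcs K c) ->
  exists B, forall n, (0 < n)%N ->
    (growth Y n <= B * n ^ (\sum_(v < c) v.+1 * size (S v)))%N.
Proof.
move=> fY SB fc; have sK : is_subgroup K by exact: generated_subgroup.
have cov : forall k, (k <= c)%N ->
    covers (heavy (c - k).+1) (\sum_(c - k <= v < c) v.+1 * size (S v)).
  elim=> [_|k IH kc].
    rewrite subn0 big_geq//; have /finite_seqP[L EL] := fc.
    move=> A; exists (size L) => n n0; exists L; first by rewrite expn0 muln1.
    move=> s hs _; have : lcs K c (weval s); last by rewrite EL.
    rewrite /weval; elim: s hs => [|l s IH] hs; first by rewrite big_nil; exact: (subg1 (lcs_subgroup sK c)).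
    rewrite big_cons; apply: (subgM (lcs_subgroup sK c)); last first.
      by apply: IH => l' l's; apply: hs; rewrite inE l's orbT.
    have [/letter_lcs ll vl] := hs l (mem_head _ _).
    by apply: lcs_le ll => //; lia.
  have E : (c - k = (c - k.+1).+1)%N by lia.
  rewrite E in IH.
  rewrite big_ltn; last by lia.
  set v := (c - k.+1)%N in IH *; have [Sl Si Sq] := SB v.
  apply: (@covers_level v.+1 (S v) _ fY _ _ (IH (ltnW kc))); first by move=> e /Sl/lcomm_letter.
  move=> e ve; have le : lcs K v e := letter_lcs ve.
  have [M M0 sp] := Sq e le.
  have [||| t At et] := @zspan_word v (S v) (e ^+ M)%g.
  - by move=> e' /Sl/lcomm_letter.
  - by apply: subgX => //; exact: lcs_subgroup.
  - rewrite (additive_onX (A := lcs K v))//; [exact: lcs_subgroup|exact: lcs_projM].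
  by exists M, t; split.
have [B HB] := cov c (leqnn c) 1%N; exists B => n n0.
have [L sL HL] := HB n n0; rewrite subnn big_mkord in sL HL.
apply: leq_trans sL.
rewrite /growth; apply: leq_trans (_ : size (fset_set (word_ball Y n)) <= _)%N => //.
apply: uniq_leq_size => // x; rewrite in_fset_set ?inE; last exact: finite_word_ball.
move=> [w [wn wY] <-].
have := HL [seq (1%N, y) | y <- w]; rewrite /weval big_map; apply.
  by move=> l /mapP[y yw ->] /=; split=> //; apply: letter_gen; exact: wY.
rewrite /wnorm big_map (eq_bigr (fun=> n%:R^-1)) => [|y _]; last by rewrite expr1.
rewrite big_const_seq count_predT iter_addr_0 -[leLHS]mulr_natl.
by rewrite ler_pdivrMr ?ltr0n// mul1r ler_nat.
Qed.

End Collection.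

(** * Powers of commutators: the lower bound for growth *)

Section LowerBound.
Variables (G : groupType) (Y : set G).
Implicit Types (x y z u : G) (v i m n : nat).
Let K := generated Y.
Let sK : is_subgroup K := generated_subgroup Y.
Let sv i : is_subgroup (lcs K i) := lcs_subgroup sK i.
Let pM i : additive_on (lcs K i) (lcs_proj K i).
Proof. exact: lcs_projM. Qed.

Lemma word_ballX n x a : word_ball Y n x -> word_ball Y (a * n) (x ^+ a)%g.
Proof.
move=> nx; elim: a => [|a IH]; first exact: word_ball0.
by rewrite expgS mulSn; exact: word_ballM.
Qed.

Lemma word_ballR m n x y : word_ball Y m x -> word_ball Y n y ->
  word_ball Y (2 * (m + n)) [~ x, y]%g.
Proof.
move=> mx ny; rewrite /commg /conjg mul2n -addnn -addnA.
apply: word_ballM; first exact: word_ballV.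
by apply: word_ballM; [exact: word_ballV|exact: word_ballM].
Qed.

Lemma word_ball_symm y : symm Y y -> word_ball Y 1 y.
Proof. by move=> Yy; exists [:: y]; rewrite ?big_seq1//; split=> // z; rewrite inE => /eqP ->. Qed.

Lemma lcomm_ball i u : lcomm Y i u -> word_ball Y (3 * 2 ^ i - 2) u.
Proof.
elim: i u => [|i IH] u /=; first exact: word_ball_symm.
move=> [[x y] [/= /IH ix /word_ball_symm Yy] <-].
apply: word_ball_le (word_ballR ix Yy); rewrite expnS.
by have : (0 < 2 ^ i)%N by [rewrite expn_gt0]; lia.
Qed.

(** If [z] and [z'] agree modulo the next term, they differ by an element whose
    commutator with [k] lies two terms further. *)
Lemma comm_proj_eq i z z' (k : G) : lcs K i z -> lcs K i z' -> K k ->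
  lcs_proj K i z = lcs_proj K i z' ->
  lcs_proj K i.+1 [~ z, k]%g = lcs_proj K i.+1 [~ z', k]%g.
Proof.
move=> iz iz' Kk zz'.
have iV := subgV (sv i) iz'; have it : lcs K i (z'^-1 * z)%g := subgM (sv i) iV iz.
have : lcs K i.+1 (z'^-1 * z)%g.
  by apply/(lcs_proj_eq0 sK it); rewrite pM// (additive_onV (sv i) (@pM i) iz') zz' addNr.
move=> St; rewrite -{1}[z](mulVKg z') (comm_additive_left sK Kk iz' it).
by rewrite [X in _ + X](lcs_projS sK) ?addr0//; exact: lcs_comm.
Qed.

(** The solution of [power_cost i.+1 = 2 * power_cost i + 3 * 2 ^ i.+1] with
    [power_cost 0 = 1], the recursion satisfied by the lengths in [power_word]. *)
Definition power_cost i := ((3 * i + 1) * 2 ^ i)%N.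

(** The digits of [a] in base [m] are used one at a time. For [u = [~ x, y]] and
    [a = b * m + r], bilinearity gives
    [u ^ a = [~ x ^ b, y ^ m] * [~ x, y ^ r]] modulo the next term, where [x ^ b]
    may be replaced by a short element that agrees with it modulo the next term. *)
Lemma power_word i u m a : lcomm Y i u -> (0 < m)%N -> (a < m ^ i.+1)%N ->
  exists z, [/\ lcs K i z, word_ball Y (power_cost i * m) z
    & lcs_proj K i z = lcs_proj K i u *+ a].
Proof.
elim: i u a => [|i IH] u a iu m0 am.
  have Ku : lcs K 0 u := lcomm_lcs iu.
  exists (u ^+ a)%g; split; first exact: (subgX a (sv 0) Ku).
    rewrite expn1 in am; apply: word_ball_le (word_ballX a (word_ball_symm iu)).
    by rewrite /power_cost; lia.
  by rewrite (additive_onX (sv 0) (@pM _)).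
case: iu => -[x y] [/= ix Yy] <-.
have bm : (a %/ m < m ^ i.+1)%N by rewrite ltn_divLR// -expnSr.
have [z [iz zb zx]] := IH x (a %/ m)%N ix m0 bm.
have lx : lcs K i x := lcomm_lcs ix; have Ky : K y := symm_generated Yy.
have KyX n : K (y ^+ n)%g := subgX n sK Ky.
have c1 := lcs_comm iz (KyX m); have c2 := lcs_comm lx (KyX (a %% m)%N).
exists ([~ z, y ^+ m] * [~ x, y ^+ (a %% m)])%g; split.
- exact: (subgM (sv i.+1) c1 c2).
- have yb n : word_ball Y n (y ^+ n)%g.
    by have := word_ballX n (word_ball_symm Yy); rewrite muln1.
  apply: word_ball_le (word_ballM (word_ballR zb (yb m))
    (word_ballR (lcomm_ball ix) (yb (a %% m)%N))).
  rewrite /power_cost expnS; have : (a %% m < m)%N by rewrite ltn_mod.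
  by have : (0 < 2 ^ i)%N by [rewrite expn_gt0]; nia.
- rewrite pM//.
  have right_pow w n : lcs K i w ->
      lcs_proj K i.+1 [~ w, y ^+ n]%g = lcs_proj K i.+1 [~ w, y]%g *+ n.
    by move=> iw; rewrite (additive_onX sK (comm_additive_right sK iw)).
  rewrite !right_pow// (comm_proj_eq (z' := (x ^+ (a %/ m))%g) iz _ Ky).
  + rewrite (additive_onX (sv i) (comm_additive_left sK Ky))//.
    by rewrite -mulrnA -mulrnDr -divn_eq.
  + exact: (subgX _ (sv i) lx).
  + by rewrite zx (additive_onX (sv i) (@pM _)).
Qed.

(** The elements that [power_word] provides for independent commutators have
    products which are pairwise distinct already modulo the next term. *)
Lemma level_many i (T : seq G) m : (forall u, u \in T -> lcomm Y i u) ->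
  zindep (map (lcs_proj K i) T) -> (0 < m)%N ->
  exists Z : seq G, [/\ uniq Z, size Z = ((m ^ i.+1) ^ size T)%N,
    {in Z &, injective (lcs_proj K i)}
    & forall z, z \in Z -> [/\ lcs K i z,
        zspan (map (lcs_proj K i) T) (lcs_proj K i z)
        & word_ball Y (size T * power_cost i * m) z]].
Proof.
move=> + + m0; elim: T => [|u T IH] Tu /=.
  move=> _; exists [:: 1%g]; split=> // [x y|z].
    by rewrite !inE => /eqP -> /eqP ->.
  rewrite inE => /eqP ->; split; [exact: (subg1 (sv i))| |exact: word_ball0].
  exact: (additive_on1 (sv i) (@pM i)).
move=> [iT uT]; have [|//|Z [uZ sZ iZ Zz]] := IH.
  by move=> x xT; apply: Tu; rewrite inE xT orbT.
have iu := Tu u (mem_head _ _).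
have /choice[f fP] : forall a, exists z, (a < m ^ i.+1)%N ->
    [/\ lcs K i z, word_ball Y (power_cost i * m) z
    & lcs_proj K i z = lcs_proj K i u *+ a].
  move=> a; have [am|] := ltnP a (m ^ i.+1)%N; last by exists 1%g.
  by have [z zP] := power_word iu m0 am; exists z.
have mN a : a \in iota 0 (m ^ i.+1) -> (a < m ^ i.+1)%N by rewrite mem_iota.
(* The exponent of [u] is determined because no nonzero multiple of [u] is in the
   span of [T]. *)
have key a a' z z' : (a < m ^ i.+1)%N -> (a' < m ^ i.+1)%N -> z \in Z -> z' \in Z ->
    lcs_proj K i (f a * z)%g = lcs_proj K i (f a' * z')%g -> a = a' /\ z = z'.
  move=> am am' zZ zZ'; have [l1 _ e1] := fP a am; have [l2 _ e2] := fP a' am'.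
  have [lz sz _] := Zz z zZ; have [lz' sz' _] := Zz z' zZ'.
  rewrite !pM// e1 e2 => E.
  have aa' : a = a'.
    apply/eqP; rewrite -eqz_nat -subr_eq0; apply/eqP; apply: uT.
    have -> : lcs_proj K i u *~ (a%:Z - a'%:Z) = lcs_proj K i z' - lcs_proj K i z.
      rewrite mulrzBr -[_ *~ a%:Z]/(_ *+ a) -[_ *~ a'%:Z]/(_ *+ a').
      by apply/eqP; rewrite subr_eq addrAC eq_sym subr_eq addrC -E addrC.
    exact: zspanB.
  split=> //; apply: iZ => //; move: E; rewrite aa'; exact: addrI.
exists [seq (f a * z)%g | a <- iota 0 (m ^ i.+1), z <- Z]; split.
- apply: allpairs_uniq => //; first exact: iota_uniq.
  move=> _ _ /allpairsP[[a z] [/= /mN am zZ ->]] /allpairsP[[a' z'] [/= /mN am' zZ' ->]] /= E.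
  by have [-> ->] := key a a' z z' am am' zZ zZ' (congr1 _ E).
- by rewrite size_allpairs size_iota sZ (expnS (m ^ i.+1)%N).
- move=> _ _ /allpairsP[[a z] [/= /mN am zZ ->]] /allpairsP[[a' z'] [/= /mN am' zZ' ->]] /= E.
  by have [-> ->] := key a a' z z' am am' zZ zZ' E.
- move=> _ /allpairsP[[a z] [/= /mN am zZ ->]].
  have [l1 b1 e1] := fP a am; have [lz sz bz] := Zz z zZ; split.
  + exact: (subgM (sv i)).
  + by exists a; rewrite pM// e1 -[_ *~ _]/(_ *+ a) addrAC subrr add0r.
  + by apply: word_ball_le (word_ballM b1 bz); rewrite !mulSn !mulnDl.
Qed.

(** Products of elements from distinct levels determine their factors: the
    factor of lowest level is read modulo the next term, and then cancelled. *)
Lemma levels_many c (T : nat -> seq G) m : (forall i u, u \in T i -> lcomm Y i u) ->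
  (forall i, zindep (map (lcs_proj K i) (T i))) -> (0 < m)%N ->
  forall k, (k <= c)%N -> exists Z : seq G,
  [/\ uniq Z, size Z = (m ^ (\sum_(c - k <= i < c) i.+1 * size (T i)))%N
    & forall z, z \in Z -> lcs K (c - k) z /\
        word_ball Y ((\sum_(c - k <= i < c) size (T i) * power_cost i) * m) z].
Proof.
move=> Tu Ti m0; elim=> [_|k IH kc].
  exists [:: 1%g]; split=> //; first by rewrite subn0 big_geq.
  move=> z; rewrite inE => /eqP ->; split; [exact: (subg1 (sv _))|exact: word_ball0].
have [Z [uZ sZ Zz]] := IH (ltnW kc).
have E : (c - k = (c - k.+1).+1)%N by lia.
rewrite E in sZ Zz; set v := (c - k.+1)%N in sZ Zz *.
have [W [uW sW iW Wz]] := level_many (Tu v) (Ti v) m0.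
have key w w' z z' : w \in W -> w' \in W -> z \in Z -> z' \in Z ->
    (w * z = w' * z')%g -> w = w' /\ z = z'.
  move=> wW wW' zZ zZ' wz; have [lw _ _] := Wz w wW; have [lw' _ _] := Wz w' wW'.
  have [lz _] := Zz z zZ; have [lz' _] := Zz z' zZ'.
  have ww' : w = w'.
    apply: iW => //; have := congr1 (lcs_proj K v) wz.
    by rewrite !(@pM _)// ?(lcs_projS sK lz) ?(lcs_projS sK lz') ?addr0//; exact: lcsS.
  by split=> //; move: wz; rewrite ww' => /mulgI.
have vc : (v < c)%N by lia.
exists [seq (w * z)%g | w <- W, z <- Z]; split.
- apply: allpairs_uniq => //.
  move=> _ _ /allpairsP[[w z] [/= wW zZ ->]] /allpairsP[[w' z'] [/= wW' zZ' ->]] /= wz.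
  by have [-> ->] := key w w' z z' wW wW' zZ zZ' wz.
- by rewrite size_allpairs sW sZ [in RHS]big_ltn// expnD expnM.
- move=> _ /allpairsP[[w z] [/= wW zZ ->]].
  have [lw _ bw] := Wz w wW; have [lz bz] := Zz z zZ; split.
    by apply: (subgM (sv v) lw); exact: lcsS.
  by rewrite big_ltn// mulnDl; exact: word_ballM.
Qed.

(** If gamma_i / gamma_(i+1) is torsion then, by bilinearity, so is
    gamma_(i+1) / gamma_(i+2). *)
Lemma level_basis_vanish v S S' : level_basis Y v S -> level_basis Y v.+1 S' ->
  S = [::] -> S' = [::].
Proof.
move=> [_ _ Sq] [Sl Si _] S0; case: S' Sl Si => // u S' Sl [_ ui]; exfalso.
have [[x y] [/= ix Yy] xyu] := Sl u (mem_head _ _).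
have lx : lcs K v x := lcomm_lcs ix; have Ky : K y := symm_generated Yy.
have [M M0 Mx] := Sq x lx; rewrite S0 /= in Mx.
suff : (M%:Z = 0 :> int) by move=> [M0']; rewrite M0' in M0.
apply: ui; rewrite -xyu -[_ *~ _]/(_ *+ M).
rewrite -(additive_onX (sv v) (comm_additive_left sK Ky) M lx).
rewrite (comm_proj_eq (z' := 1%g) _ _ Ky); last first.
- by rewrite (additive_onX (sv v) (@pM _))// Mx (additive_on1 (sv v) (@pM _)).
- exact: (subg1 (sv v)).
- exact: (subgX _ (sv v) lx).
rewrite comm1g (lcs_projS sK); first exact: zspan0.
exact: (subg1 (sv _)).
Qed.

(** At most [d] commutators of weight at most [d] suffice to reach total weight [d]:
    a single one if weight [d] occurs; otherwise all weights are below [d], and one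
    takes [d] commutators, or all of them if there are fewer than [d]. This makes
    the constant in the lower bound depend on [d] only. *)
Lemma select_weights (s : nat -> nat) c d :
  (forall v, s v = 0 -> s v.+1 = 0)%N -> (0 < d)%N ->
  (d <= \sum_(v < c) v.+1 * s v)%N ->
  exists t : nat -> nat, [/\ forall v, (t v <= s v)%N,
    forall v, (0 < t v)%N -> (v < d)%N, (\sum_(v < c) t v <= d)%N
    & (d <= \sum_(v < c) v.+1 * t v)%N].
Proof.
move=> s0 d0 ds.
have s0' v w : (v <= w)%N -> s v = 0%N -> s w = 0%N.
  by move=> /subnK <- sv0; elim: (w - v)%N => [//|n]; exact: s0.
have [/andP[sd dc]|nd] := boolP ((0 < s d.-1)%N && (d.-1 < c)%N).
  exists (fun v => (v == d.-1) : nat); split.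
  - by move=> v; case: eqP => // ->.
  - by move=> v; case: eqP => // -> _; lia.
  - by rewrite (bigD1 (Ordinal dc))//= eqxx big1// => i /negbTE; rewrite -val_eqE /= => ->.
  - by rewrite (bigD1 (Ordinal dc))//= eqxx muln1 prednK// leq_addr.
have sd v : (v < c)%N -> (d.-1 <= v)%N -> s v = 0%N.
  move=> vc dv; move: nd; rewrite negb_and -eqn0Ngt -leqNgt => /orP[/eqP /(s0' _ _ dv)//|].
  by lia.
have [t [ts td tT]] : exists t : nat -> nat, [/\ forall v, (t v <= s v)%N,
    forall v, (c <= v)%N -> t v = 0%N &
    (\sum_(v < c) t v <= d)%N /\ ((\sum_(v < c) t v = d)%N \/ forall v, (v < c)%N -> t v = s v)].
  elim: {ds nd sd} c => [|c [t [ts td [tT td']]]].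
    by exists (fun=> 0%N); split=> //; split=> //; [rewrite big_ord0|right].
  exists (fun v => if v == c then minn (s c) (d - \sum_(v < c) t v) else t v); split.
  - by move=> v; case: eqP => [->|_]; rewrite ?geq_minl.
  - by move=> v cv; case: eqP => [E|_]; [move: cv; lia|apply: td; lia].
  rewrite big_ord_recr /= eqxx.
  rewrite (eq_bigr (fun v : 'I_c => t v)); last first.
    by move=> v _; rewrite ifF//; apply/negbTE; rewrite neq_ltn ltn_ord.
  move: (\sum_(v < c) t v)%N tT td' => N tT td'.
  split; first by move: tT; lia.
  case: td' => [E|E]; first by left; lia.
  have [le|le] := leqP (s c) (d - N)%N.
    right=> v; rewrite ltnS leq_eqVlt; case: eqP => [->|_ /E//] _; lia.
  by left; lia.
exists t; split=> //.
- move=> v tv; rewrite ltnNge; apply/negP => dv.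
  have [cv|vc] := leqP c v; first by rewrite td in tv.
  by move: (ts v) tv; rewrite (sd v vc) ?leqn0 => [/eqP->//|]; lia.
- by case: tT.
case: tT => _ [E|E].
  by rewrite -{1}E; apply: leq_sum => v _; rewrite leq_pmull.
by rewrite (eq_bigr (fun v : 'I_c => v.+1 * s v)%N)// => v _; rewrite E.
Qed.

Lemma power_cost_le i j : (i <= j)%N -> (power_cost i <= power_cost j)%N.
Proof. by move=> ij; rewrite leq_mul ?leq_exp2l//; lia. Qed.

(** The commutators selected by [select_weights] yield at least [m ^ d] distinct
    products, each with at most [d] factors of length at most
    [power_cost d.-1 * m]. *)
Theorem growth_lower_bound c (S : nat -> seq G) d m : finite_set Y ->
  (forall v, level_basis Y v (S v)) -> (0 < d)%N -> (0 < m)%N ->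
  (d <= \sum_(v < c) v.+1 * size (S v))%N ->
  (m ^ d <= growth Y (d * power_cost d.-1 * m))%N.
Proof.
move=> fY SB d0 m0 dS.
have [t [ts td tT dt]] := select_weights (s := fun v => size (S v))
  (fun v => fun s0 => congr1 size (level_basis_vanish (SB v) (SB v.+1) (size0nil s0))) d0 dS.
pose T v := drop (size (S v) - t v) (S v).
have sT v : size (T v) = t v by rewrite size_drop subKn.
have Tu v u : u \in T v -> lcomm Y v u.
  by move=> /mem_drop uS; have [+ _ _] := SB v; apply.
have zdrop (V : zmodType) n (s : seq V) : zindep s -> zindep (drop n s).
  by elim: s n => // a s IH [|n] //= [/IH].
have Ti v : zindep (map (lcs_proj K v) (T v)).
  by rewrite map_drop; apply: zdrop; case: (SB v).
have [Z [uZ sZ Zz]] := levels_many (c := c) Tu Ti m0 (leqnn c).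
rewrite subnn !big_mkord in sZ Zz.
apply: leq_trans (_ : size Z <= _)%N.
  by rewrite sZ leq_pexp2l//; under eq_bigr do rewrite sT.
rewrite /growth; apply: uniq_leq_size => // z zZ.
rewrite in_fset_set ?inE; last exact: finite_word_ball.
have [_ bz] := Zz z zZ; apply: word_ball_le bz; rewrite leq_mul2r; apply/orP; right.
apply: leq_trans (_ : (\sum_(i < c) t i) * power_cost d.-1 <= _)%N; last first.
  by rewrite leq_mul2r tT orbT.
rewrite big_distrl; apply: leq_sum => v _ /=; rewrite sT.
have [->//|tv] := posnP (t v); rewrite leq_mul2l power_cost_le ?orbT//.
by move: (td v tv); lia.
Qed.

End LowerBound.

(** * Subgroups of finite index *)

Section FiniteIndex.
Variable G : groupType.
Implicit Types (H X Y : set G) (g h x y z : G).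

(** A finite-index subgroup is handled through any map that separates exactly its
    right cosets, such as the translation of left cosets or the matrix of a linear
    action; the length of [S] bounds the index. *)
Definition coset_map H (T : eqType) (mu : G -> T) (S : seq T) :=
  (forall g h, mu g = mu h <-> H (g * h^-1)%g) /\ (forall g, mu g \in S).

Definition finite_index H := exists (T : eqType) (mu : G -> T) S, coset_map H mu S.

Section CosetMap.
Variables (H : set G) (T : eqType) (mu : G -> T) (S : seq T).
Hypothesis muH : coset_map H mu S.

Lemma coset_mapM g h x : mu g = mu h -> mu (g * x)%g = mu (h * x)%g.
Proof. by case: muH => muE _ /muE gh; apply/muE; rewrite invgM mulgA mulgK. Qed.

Lemma coset_map1 g : mu g = mu 1%g <-> H g.
Proof. by case: muH => muE _; rewrite muE invg1 mulg1. Qed.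

Lemma finite_index_power g : exists2 q, (0 < q)%N & H (g ^+ q)%g.
Proof.
have [muE muS] := muH.
pose s := [seq mu (g ^+ i)%g | i <- iota 0 (size S).+1].
have : ~~ uniq s.
  apply/negP => us; have : (size s <= size S)%N.
    by apply: uniq_leq_size => // _ /mapP[i _ ->].
  by rewrite size_map size_iota ltnn.
move=> /(uniqPn (mu 1%g))[i [j [ij]]]; rewrite size_map size_iota => js.
rewrite !(nth_map 0%N) ?size_iota ?(ltn_trans ij)// !nth_iota ?(ltn_trans ij)// !add0n.
move=> /esym/muE; exists (j - i)%N; first by rewrite subn_gt0.
by rewrite expgnFr//; exact: ltnW.
Qed.

(** The number of cosets met by the ball of radius [j] increases strictly with [j]
    until it is stationary, and all cosets are met from then on. *)
Lemma coset_ball X g : generating_set X ->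
  exists2 t, word_ball X (size S).-1 t & mu t = mu g.
Proof.
move=> [_ gX]; have [_ muS] := muH.
pose A j m := `[< exists2 t, word_ball X j t & mu t = m >].
pose cnt j := size [seq m <- undup S | A j m].
have cle j : (cnt j <= size S)%N.
  by apply: leq_trans (size_undup S); rewrite /cnt size_filter count_size.
have AS i j m : (i <= j)%N -> A i m -> A j m.
  by move=> ij /asboolP[t it <-]; apply/asboolP; exists t => //; exact: word_ball_le it.
have key j : (j < cnt j)%N \/ forall g, exists2 t, word_ball X j t & mu t = mu g.
  elim: j => [|j [IH|IH]].
  - left; rewrite /cnt lt0n size_eq0 -has_filter; apply/hasP; exists (mu 1%g).
      by rewrite mem_undup.
    by apply/asboolP; exists 1%g => //; exact: word_ball0.
  - have [lt|ge] := ltnP (cnt j) (cnt j.+1); first by left; exact: leq_ltn_trans lt.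
    right => {}g.
    have Aj m : A j.+1 m -> A j m.
      move=> Am; have mS : m \in undup S.
        by move: Am => /asboolP[t _ <-]; rewrite mem_undup.
      have sub : {subset [seq m <- undup S | A j m] <= [seq m <- undup S | A j.+1 m]}.
        by move=> m'; rewrite !mem_filter => /andP[/AS-> // ->].
      have [_ E] := uniq_min_size (filter_uniq _ (undup_uniq S)) sub ge.
      by have := E m; rewrite !mem_filter Am mS !andbT => ->.
    have : exists n, word_ball X n g by apply: generated_word_ball; rewrite gX.
    move=> [n [w [_ wX] <-]].
    suff [t tj tg] : exists2 t, word_ball X j t & mu t = mu (\prod_(x <- w) x)%g.
      by exists t => //; exact: word_ball_le tj.
    elim/last_ind: w wX => [_|w a IHw wX].
      by exists 1%g; [exact: word_ball0|rewrite big_nil].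
    have [|t tj tw] := IHw.
      by move=> x xw; apply: wX; rewrite mem_rcons inE xw orbT.
    have /Aj/asboolP[t' t'j E] : A j.+1 (mu (t * a)%g).
      apply/asboolP; exists (t * a)%g => //; rewrite -addn1; apply: word_ballM => //.
      exists [:: a]; rewrite ?big_seq1//; split=> // x; rewrite inE => /eqP->.
      by apply: wX; rewrite mem_rcons mem_head.
    exists t' => //; rewrite E -cats1 big_cat big_seq1.
    exact: coset_mapM.
  - right => {}g; have [t tj <-] := IH g; exists t => //.
    by apply: word_ball_le tj.
have [lt|] := key (size S).-1; last exact.
have S0 : (0 < size S)%N by case: S (muS 1%g).
have : A (size S).-1 (mu g); last by move=> /asboolP.
rewrite prednK// in lt.
have sall : all (A (size S).-1) (undup S).
  rewrite all_count -size_filter -/(cnt _) eqn_leq; apply/andP; split.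
    by rewrite /cnt size_filter count_size.
  exact: leq_trans (size_undup _) lt.
by move/allP: sall; apply; rewrite mem_undup.
Qed.

(** The Reidemeister-Schreier method. Reading a word of length [n] from left to
    right and replacing each prefix by its representative writes it as a product of
    [n] generators of [H] and one representative; the representatives can be taken
    in the ball of radius [size S - 1]. *)
Theorem schreier X : is_subgroup H -> generating_set X ->
  exists Y N, [/\ finite_set Y, generated Y = H,
    Y `<=` word_ball X (2 * size S - 1) & forall n, (growth X n <= growth Y n * N)%N].
Proof.
move=> sH genX; have [muE muS] := muH; have [fX gX] := genX.
have S0 : (0 < size S)%N by case: S (muS 1%g).
have /choice[t tP] : forall m, exists t, (exists g, mu g = m) ->
    word_ball X (size S).-1 t /\ mu t = m.
  move=> m; have [[g gm]|nm] := pselect (exists g, mu g = m); last by exists 1%g.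
  by have [t tb tg] := coset_ball g genX; exists t; rewrite tg.
(* The coset [H] is represented by 1, so that an element of [H] is exactly a word
   in the generators. *)
pose tr g := if `[< H g >] then 1%g else t (mu g).
have tr_mu g : mu (tr g) = mu g.
  rewrite /tr; case: asboolP => [/coset_map1//|_].
  by have [|] := tP (mu g); first by exists g.
have tr_ball g : word_ball X (size S).-1 (tr g).
  rewrite /tr; case: asboolP => [_|_]; first exact: word_ball0.
  by have [|] := tP (mu g); first by exists g.
have tr_eq g h : mu g = mu h -> tr g = tr h.
  move=> gh; rewrite /tr gh; congr (if _ then _ else _).
  by apply/asboolP/asboolP => /coset_map1; [rewrite gh|rewrite -gh] => /coset_map1.
pose L := 1%g :: map t S.
have trL g : tr g \in L.
  by rewrite /tr inE; case: asboolP => _; rewrite ?eqxx// map_f ?orbT.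
pose gen (p : G * G) := (p.1 * p.2 * (tr (p.1 * p.2))^-1)%g.
pose Y := [set gen p | p in range tr `*` symm X].
have fS : finite_set (symm X) by exact: finite_symm.
have fr : finite_set (range tr).
  by apply: (sub_finite_set _ (finite_seq L)) => _ [g _ <-]; exact: trL.
have fY : finite_set Y by apply: finite_image; exact: finite_setX.
have YH : Y `<=` H.
  by move=> _ [p _ <-]; apply/muE; rewrite tr_mu.
have YX : Y `<=` word_ball X (2 * size S - 1).
  move=> _ [[_ x] [/= [g _ <-] Xx] <-]; rewrite /gen /=.
  have -> : (2 * size S - 1 = ((size S).-1 + 1) + (size S).-1)%N by lia.
  apply: word_ballM; last exact: word_ballV.
  apply: word_ballM => //; exists [:: x]; rewrite ?big_seq1//.
  by split=> // y; rewrite inE => /eqP->.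
have rewriting (w : seq G) : (forall x, x \in w -> X x \/ X x^-1%g) ->
    exists2 y, word_ball Y (size w) y & (\prod_(x <- w) x = y * tr (\prod_(x <- w) x))%g.
  elim/last_ind: w => [_|w a IH wX].
    exists 1%g; first exact: word_ball0.
    rewrite big_nil /tr; case: asboolP => [_|[]]; first by rewrite mulg1.
    exact: subg1.
  have [|y yw E] := IH; first by move=> x xw; apply: wX; rewrite mem_rcons inE xw orbT.
  have Xa : symm X a by apply: wX; rewrite mem_rcons mem_head.
  rewrite -cats1 big_cat big_seq1; set z := (\prod_(x <- w) x)%g in E *.
  exists (y * gen (tr z, a))%g.
    rewrite size_cat addn1 -addn1; apply: word_ballM => //.
    exists [:: gen (tr z, a)]; rewrite ?big_seq1//; split=> // x.
    rewrite inE => /eqP->; left; exists (tr z, a) => //; split=> //=; by exists z.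
  rewrite /gen /= (tr_eq (tr z * a)%g (z * a)%g); last exact: coset_mapM.
  by rewrite {1}E !mulgA mulgVK.
have ball n x : word_ball X n x -> exists2 y, word_ball Y n y & (x = y * tr x)%g.
  move=> [w [wn wX] <-]; have [y yw E] := rewriting w wX.
  by exists y => //; exact: word_ball_le yw.
exists Y, (size L); split=> //.
- apply/seteqP; split; first exact: generated_sub.
  move=> h Hh; have [n hn] : exists n, word_ball X n h.
    by apply: generated_word_ball; rewrite gX.
  have [y yn] := ball n h hn; rewrite /tr asboolT// mulg1 => ->.
  exact: word_ball_generated yn.
- move=> n; rewrite /growth.
  rewrite -(size_allpairs (fun y s => (y * s)%g)).
  apply: uniq_leq_size => // x; rewrite in_fset_set ?inE; last exact: finite_word_ball.
  move=> /ball[y yn ->]; apply/allpairsP; exists (y, tr x); split=> //=.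
  by rewrite in_fset_set ?inE//; exact: finite_word_ball.
Qed.

End CosetMap.

Lemma left_cosets_finite_index H : is_subgroup H -> finite_set (left_cosets H) ->
  finite_index H.
Proof.
move=> sH fH; exists (set G), (fun g => [set (g^-1 * h)%g | h in H]).
exists (fset_set (left_cosets H)); split=> [g h|g]; last first.
  by rewrite in_fset_set// inE; exists g^-1%g.
split=> [gh|Hgh].
  have : [set (h^-1 * k)%g | k in H] h^-1%g by exists 1%g; [exact: subg1|rewrite mulg1].
  rewrite -gh => -[k Hk kh]; have -> : (g * h^-1 = k)%g by rewrite -kh mulVKg.
  by [].
apply/seteqP; split=> _ [k Hk <-].
  exists ((g * h^-1)^-1 * k)%g; first by apply: subgM => //; exact: subgV.
  by rewrite !gnorm.
exists ((g * h^-1) * k)%g; first exact: subgM.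
by rewrite !gnorm.
Qed.

Definition core H : set G := [set g | forall x, H (g ^ x)%g].

Lemma core_subgroup H : is_subgroup H -> is_subgroup (core H).
Proof.
move=> sH; split=> [x|g h Cg Ch x|g Cg x].
- by rewrite conj1g; exact: subg1.
- by rewrite conjMg; exact: (subgM sH (Cg x) (Ch x)).
- by rewrite conjVg; exact: (subgV sH (Cg x)).
Qed.

Lemma core_sub H : core H `<=` H.
Proof. by move=> g /(_ 1%g); rewrite conjg1. Qed.

Lemma core_normal H g x : core H g -> core H (g ^ x)%g.
Proof. by move=> Cg y; rewrite -conjgM. Qed.

Lemma all_seqs_finite (T : eqType) (S : seq T) k : exists L : seq (seq T),
  forall s, size s = k -> {subset s <= S} -> s \in L.
Proof.
elim: k => [|k [L HL]]; first by exists [:: [::]] => s /size0nil ->.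
exists [seq a :: s | a <- S, s <- L] => -[//|a s] /= [sk] sS.
apply/allpairsP; exists (a, s); split=> //=; first by apply: sS; rewrite mem_head.
by apply: HL => // x xs; apply: sS; rewrite inE xs orbT.
Qed.

(** The core is the kernel of the action on the cosets of [H]: the coset of [g] is
    determined by the images under [g] of a set of representatives. *)
Lemma finite_index_core H : is_subgroup H -> finite_index H -> finite_index (core H).
Proof.
move=> sH [T [mu [S [muE muS]]]].
have /choice[t tP] : forall m, exists t, (exists g, mu g = m) -> mu t = m.
  move=> m; have [[g gm]|nm] := pselect (exists g, mu g = m); last by exists 1%g.
  by exists g.
have tmu g : mu (t (mu g)) = mu g by apply: tP; exists g.
pose nu g := [seq mu (t m * g)%g | m <- S].
have [L HL] := all_seqs_finite S (size S).
exists (seq T), nu, L; split=> [g h|g]; last first.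
  by apply: HL; [rewrite size_map|move=> _ /mapP[m _ ->]].
rewrite /core /=; split=> [/eq_in_map E x|E]; last first.
  apply/eq_in_map => m mS; apply/muE; rewrite invgM !mulgA.
  by have := E (t m)^-1%g; rewrite conjgE invgK !mulgA.
have := E (mu x^-1%g) (muS _) => /muE; set u := t _.
have [k Hk uk] : exists2 k, H k & (x^-1 = k * u)%g.
  exists (x^-1 * u^-1)%g; last by rewrite mulgVK.
  by apply/muE; rewrite tmu.
move=> Hu; have -> : ((g * h^-1) ^ x = k * (u * g * (u * h)^-1) * k^-1)%g.
  have -> : k = (x^-1 * u^-1)%g by rewrite uk mulgK.
  by rewrite conjgE !gnorm.
by apply: subgM; [done|apply: subgM|exact: subgV].
Qed.

End FiniteIndex.

Section Degree.
Variables (R : realType) (G : groupType).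

(** [ln (B n ^ D) / ln n] tends to [D]. *)
Lemma growth_degree_le (X : set G) (B D : nat) : generating_set X ->
  (forall n, (0 < n)%N -> (growth X n <= B * n ^ D)%N) ->
  (growth_degree R G <= D%:R%:E)%E.
Proof.
move=> gX bX; rewrite (growth_degreeE R gX).
have fX : finite_set X by case: gX.
have B0 : (0 < B)%N.
  by have := leq_trans (growth_gt0 1 fX) (bX 1%N isT); rewrite exp1n muln1.
apply/lee_addgt0Pr => e e0.
(* From [N] on, [ln B <= e * ln n]. *)
pose N := maxn 2 (Num.truncn (expR (ln B%:R / e))).+1.
apply: ge_ereal_inf; exists (ereal_sup
  [set (ln (growth X n)%:R / ln n%:R : R)%:E | n in [set n | (N <= n)%N]]).
  by exists [set n | (N <= n)%N] => //; exists N.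
apply: ge_ereal_sup => _ [n /= Nn <-]; rewrite -EFinD lee_fin.
move: Nn; rewrite geq_max => /andP[n2 n3].
have n0 : (0 < n)%N by exact: leq_trans n2.
have ln0 : 0 < ln n%:R :> R by rewrite ln_gt0// ltr1n.
rewrite ler_pdivrMr//.
have : ln (growth X n)%:R <= ln (B * n ^ D)%:R :> R.
  by rewrite ler_ln ?posrE ?ltr0n ?growth_gt0 ?muln_gt0 ?B0 ?expn_gt0 ?n0// ler_nat bX.
move=> /le_trans; apply.
rewrite natrM lnM ?posrE ?ltr0n ?expn_gt0 ?n0// natrX lnXn ?ltr0n//.
rewrite mulrDl addrC mulr_natl lerD2l -ler_pdivrMl// mulrC -[leLHS]expRK.
rewrite ler_ln ?posrE ?expR_gt0 ?ltr0n//.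
by apply/ltW/(lt_le_trans (truncnS_gt _)); rewrite ler_nat.
Qed.

End Degree.

(** * Transfer, and finite-by-nilpotent overgroups *)

Section Transfer.
Variable G : groupType.
Implicit Types (A B C : set G) (x y z : G).

Definition rel_finite_index A B := exists T : seq G,
  (forall t, t \in T -> A t) /\ forall x, A x -> exists2 t, t \in T & B (t^-1 * x)%g.

Lemma rel_finite_index_trans A B C : is_subgroup A -> B `<=` A ->
  rel_finite_index A B -> rel_finite_index B C -> rel_finite_index A C.
Proof.
move=> sA BA [T [TA TB]] [U [UB UC]]; exists [seq (t * u)%g | t <- T, u <- U]; split.
  by move=> _ /allpairsP[[t u] [/= /TA At /UB/BA Au ->]]; exact: subgM.
move=> x Ax; have [t tT Btx] := TB x Ax; have [u uU Cux] := UC _ Btx.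
exists (t * u)%g; last by rewrite invgM -mulgA.
by apply/allpairsP; exists (t, u).
Qed.

Section Transversal.
Variables (A B : set G).
Hypotheses (sA : is_subgroup A) (sB : is_subgroup B) (BA : B `<=` A).
Hypothesis AB : rel_finite_index A B.

(** Choosing the first element of [T] in each coset gives a representative that
    depends only on the coset; the list [T] itself may meet a coset several
    times. *)
Lemma transversal : exists (U : seq G) (r : G -> G), [/\ uniq U,
  (forall u, u \in U -> A u /\ r u = u),
  (forall x, A x -> r x \in U /\ B ((r x)^-1 * x)%g)
  & forall x y, B (x^-1 * y)%g -> r x = r y].
Proof.
have [T [TA TB]] := AB.
pose p x t := `[< B (t^-1 * x)%g >].
pose r x := nth 1%g T (find (p x) T).
have rx x : A x -> r x \in T /\ B ((r x)^-1 * x)%g.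
  move=> Ax; have [t tT Btx] := TB x Ax.
  have hp : has (p x) T by apply/hasP; exists t => //; apply/asboolP.
  split; first by rewrite mem_nth// -has_find.
  by apply/asboolP; exact: (nth_find 1%g hp).
have rr x y : B (x^-1 * y)%g -> r x = r y.
  move=> Bxy; rewrite /r; congr (nth _ _ _); apply: eq_find => t; rewrite /p.
  apply: asbool_equiv_eq; split=> Bt.
    have -> : (t^-1 * y = (t^-1 * x) * (x^-1 * y))%g by rewrite !gnorm.
    exact: subgM.
  have -> : (t^-1 * x = (t^-1 * y) * (x^-1 * y)^-1)%g by rewrite !gnorm.
  by apply: subgM => //; exact: subgV.
exists (undup [seq r t | t <- T]), r; split=> //; first exact: undup_uniq.
  move=> u; rewrite mem_undup => /mapP[t tT ->]; have [rT Br] := rx t (TA t tT).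
  by split; [exact: TA|exact: rr].
move=> x Ax; split; last by case: (rx x Ax).
have [t tT Btx] := TB x Ax; rewrite mem_undup -(rr t x Btx); exact: map_f.
Qed.

Lemma rel_finite_index_power x : A x -> exists2 q, (0 < q)%N & B (x ^+ q)%g.
Proof.
move=> Ax; have [U [r [uU Ur rU rr]]] := transversal.
pose s := [seq r (x ^+ i)%g | i <- iota 0 (size U).+1].
have : ~~ uniq s.
  apply/negP => us; have : (size s <= size U)%N.
    apply: uniq_leq_size => // _ /mapP[i _ ->].
    by case: (rU (x ^+ i)%g) => //; exact: subgX.
  by rewrite size_map size_iota ltnn.
move=> /(uniqPn 1%g)[i [j [ij]]]; rewrite size_map size_iota => js.
rewrite !(nth_map 0%N) ?size_iota ?(ltn_trans ij)// !nth_iota ?(ltn_trans ij)// !add0n.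
move=> E; have [_ Bi] := rU _ (subgX i sA Ax); have [_ Bj] := rU _ (subgX j sA Ax).
exists (j - i)%N; first by rewrite subn_gt0.
rewrite -(subnK (ltnW ij)) addnC expgnDr in Bj.
have -> : (x ^+ (j - i) = ((r (x ^+ i))^-1 * x ^+ i)^-1 * ((r (x ^+ i))^-1 * (x ^+ i * x ^+ (j - i))))%g.
  by rewrite !gnorm.
apply: subgM => //; first exact: subgV.
rewrite E; move: Bj; rewrite -expgnDr subnKC//; exact: ltnW.
Qed.

(** The transfer, composed with [f]: the sum of the elements of [B] by which [x]
    permutes the representatives [u] of the cosets of [B]. On [B], which is normal,
    each coset is fixed and each term is a conjugate of [x]. *)
Lemma transfer (V : zmodType) (f : G -> V) : normalizes A B -> additive_on B f ->
  (forall x a, B x -> A a -> f (x ^ a)%g = f x) ->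
  exists (tau : G -> V) p, [/\ (0 < p)%N, additive_on A tau
    & forall x, B x -> tau x = f x *+ p].
Proof.
move=> nB fM fJ; have [U [r [uU Ur rU rr]]] := transversal.
exists (fun x => \sum_(u <- U) f ((r (x * u))^-1 * (x * u))%g), (size U); split.
- by have [] := rU 1%g (subg1 sA); case: (U).
- move=> x y Ax Ay.
  have BU z u : A z -> u \in U -> B ((r (z * u))^-1 * (z * u))%g.
    by move=> Az /Ur[Au _]; case: (rU (z * u)%g) => //; exact: subgM.
  have rmul u : u \in U -> r (x * y * u)%g = r (x * r (y * u))%g.
    move=> uIn; apply/esym/rr.
    have -> : ((x * r (y * u))^-1 * (x * y * u) = (r (y * u))^-1 * (y * u))%g.
      by rewrite !gnorm.
    exact: BU.
  have pU : perm_eq U [seq r (y * u)%g | u <- U].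
    have sub : {subset [seq r (y * u)%g | u <- U] <= U}.
      move=> _ /mapP[u /Ur[Au _] ->].
      by case: (rU (y * u)%g) => //; exact: subgM.
    have uni : uniq [seq r (y * u)%g | u <- U].
      rewrite map_inj_in_uniq// => u v uIn vIn E.
      have [[Au ru] [Av rv]] := (Ur u uIn, Ur v vIn).
      rewrite -ru -rv; apply: rr.
      have -> : (u^-1 * v = ((r (y * u))^-1 * (y * u))^-1 * ((r (y * v))^-1 * (y * v)))%g.
        by rewrite E !gnorm.
      by apply: subgM => //; [apply: subgV => //|]; exact: BU.
    rewrite perm_sym; apply: uniq_perm => //.
    by case: (uniq_min_size uni sub); rewrite ?size_map.
  rewrite [in RHS](perm_big _ pU) big_map -big_split /=; apply: eq_big_seq => u uIn.
  rewrite rmul// -fM; last exact: BU.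
    by congr f; rewrite !gnorm.
  by apply: BU => //; rewrite (perm_mem pU); exact: (map_f (fun u => r (y * u)%g) uIn).
- move=> x Bx; rewrite (eq_big_seq (fun=> f x)).
    by rewrite big_const_seq count_predT iter_addr_0.
  move=> u uIn; have [Au ru] := Ur u uIn.
  have -> : r (x * u)%g = u by rewrite -[RHS]ru; apply/esym/rr; exact: nB.
  exact: fJ.
Qed.

End Transversal.
End Transfer.

Section Isolators.
Variables (G : groupType) (N : set G).
Hypothesis sN : is_subgroup N.
Let sv i : is_subgroup (lcs N i) := lcs_subgroup sN i.
Let pM i : additive_on (lcs N i) (lcs_proj N i).
Proof. exact: lcs_projM. Qed.

(** The elements of gamma_i with a power in gamma_(i+1); dividing by this subgroup
    makes the quotient torsion-free. *)
Definition isolator i : set G := [set x | lcs N i x /\ torsion (lcs_proj N i x)].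

Lemma isolator_section i : abelian_section (lcs N i) (isolator i).
Proof.
split=> //; [|by move=> x []|].
  split=> [|x y [lx tx] [ly ty]|x [lx tx]]; split.
  - exact: (subg1 (sv i)).
  - by rewrite (additive_on1 (sv i) (@pM i)); exact: torsion0.
  - exact: (subgM (sv i)).
  - by rewrite pM//; exact: torsionD.
  - exact: (subgV (sv i)).
  - by rewrite (additive_onV (sv i) (@pM i))//; exact: torsionN.
move=> x y lx ly; have lr := lcs_comm lx (lcs_sub sN ly).
by split; [exact: (lcsS sN)|rewrite (lcs_projS sN lr); exact: torsion0].
Qed.

Definition free_proj i : G -> quo (lcs N i) (isolator i) := qproj (lcs N i) (isolator i).

Lemma free_projM i : additive_on (lcs N i) (free_proj i).
Proof. by move=> x y; apply: qprojM; exact: isolator_section. Qed.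

Lemma free_proj_eq0 i x : lcs N i x -> free_proj i x = 0 <-> isolator i x.
Proof. by move=> lx; apply: qproj_eq0 => //; exact: isolator_section. Qed.

Lemma free_quo_torsionfree i (v : quo (lcs N i) (isolator i)) m :
  (0 < m)%N -> v *+ m = 0 -> v = 0.
Proof.
move=> m0; have [x lx <-] := qproj_surj v (isolator_section i).
rewrite -/(free_proj i x) -(additive_onX (sv i) (@free_projM i))//.
move=> /free_proj_eq0[|_ [n n0]]; first exact: (subgX m (sv i)).
rewrite (additive_onX (sv i) (@pM i))// => xn; apply/free_proj_eq0 => //; split=> //.
by exists (m * n)%N; rewrite ?muln_gt0 ?m0// mulrnA.
Qed.

End Isolators.

Section NilpotentByFinite.
Variables (G : groupType) (Y N K : set G).
Hypotheses (fY : finite_set Y) (gY : generated Y = N).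
Hypotheses (sK : is_subgroup K) (NK : N `<=` K).
Hypothesis (nN : normalizes K N) (KN : rel_finite_index K N).
Hypothesis (tK : forall x k, N x -> K k ->
  exists2 m, (0 < m)%N & lcs N 1 ([~ x, k] ^+ m)%g).

Let sN : is_subgroup N.
Proof. by rewrite -gY; exact: generated_subgroup. Qed.
Let sv i : is_subgroup (lcs N i) := lcs_subgroup sN i.
Let pM i : additive_on (lcs N i) (lcs_proj N i).
Proof. exact: lcs_projM. Qed.

Let nlcs i x k : K k -> lcs N i x -> lcs N i (x ^ k)%g.
Proof. by move=> Kk; apply: lcs_normal_by => // y Ny; exact: nN. Qed.

(** Acting trivially on the first quotient modulo torsion forces it on all of them,
    because gamma_(i+1) / gamma_(i+2) is generated by the image of a bilinear map.
    For the second argument one uses that commuting gamma_i with gamma_2 leads into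
    gamma_(i+2). *)
Lemma lcs_act_torsion i x k : lcs N i x -> K k ->
  torsion (lcs_proj N i (x ^ k)%g - lcs_proj N i x).
Proof.
move=> + Kk; elim: i x => [|i IH] x.
  move=> Nx; have [m m0 xm] := tK Nx Kk; exists m => //.
  have Nxk : N (x ^ k)%g by exact: nN.
  have Nr : lcs N 0 [~ x, k]%g by rewrite commgEl; apply: (subgM sN) => //; exact: (subgV sN).
  rewrite addrC -(additive_onV (sv 0) (@pM 0) Nx) -pM//; last exact: (subgV sN Nx).
  by rewrite -commgEl -(additive_onX (sv 0) (@pM 0) _ Nr); apply: lcs_projS.
move=> /(_ [set z | lcs N i.+1 z /\
   torsion (lcs_proj N i.+1 (z ^ k)%g - lcs_proj N i.+1 z)])[]//; split.
  split=> [|z w [lz tz] [lw tw]|z [lz tz]] /=.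
  - split; first exact: (subg1 (sv i.+1)).
    by rewrite conj1g subrr; exact: torsion0.
  - split; first exact: (subgM (sv i.+1) lz lw).
    rewrite conjMg (pM (nlcs Kk lz) (nlcs Kk lw)) (pM lz lw).
    by rewrite opprD addrACA; exact: torsionD.
  - split; first exact: (subgV (sv i.+1) lz).
    rewrite conjVg (additive_onV (sv i.+1) (@pM _) (nlcs Kk lz)).
    rewrite (additive_onV (sv i.+1) (@pM _) lz).
    by rewrite -opprD; exact: torsionN.
move=> _ [[z n] [/= lz Nn] <-]; split; first exact: lcs_comm.
have Nnk : N (n ^ k)%g by exact: nN.
have lzk : lcs N i (z ^ k)%g by exact: nlcs.
have lr : lcs N i [~ z, k]%g by rewrite commgEl; apply: (subgM (sv i)) => //; exact: (subgV (sv i)).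
have Nr : N [~ n, k]%g by rewrite commgEl; apply: (subgM sN) => //; exact: (subgV sN).
rewrite conjRg -[(z ^ k)%g](mulVKg z) -(commgEl z k) -{1}[(n ^ k)%g](mulVKg n) -(commgEl n k).
rewrite (comm_additive_left sN (subgM sN Nn Nr) lz lr) (comm_additive_right sN lz Nn Nr).
rewrite addrAC [_ + _ - _]addrAC subrr add0r; apply: torsionD.
  have [m m0 nm] := tK Nn Kk; exists m => //.
  rewrite -(additive_onX sN (comm_additive_right sN lz) m Nr); apply: lcs_projS => //.
  by rewrite -[i.+2](addn1 i.+1) addSn; apply: lcs_comm_lcs.
have [m m0 zm] := IH z lz; exists m => //.
have Nnr := subgM sN Nn Nr.
rewrite -(additive_onX (sv i) (comm_additive_left sN Nnr) m lr); apply: lcs_projS => //.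
apply: lcs_comm => //; apply/(lcs_proj_eq0 sN); first exact: (subgX m (sv i) lr).
rewrite (additive_onX (sv i) (@pM i))// commgEl pM//; last exact: (subgV (sv i) lz).
by rewrite (additive_onV (sv i) (@pM i))// addrC.
Qed.

Lemma free_projJ i x k : lcs N i x -> K k -> free_proj N i (x ^ k)%g = free_proj N i x.
Proof.
move=> lx Kk; apply/esym/qproj_eq => //; [exact: (isolator_section sN)|exact: nlcs|].
have lxk : lcs N i (x ^ k)%g by exact: nlcs.
have lV := subgV (sv i) lx; split; first exact: (subgM (sv i)).
rewrite pM// (additive_onV (sv i) (@pM i))// addrC; exact: lcs_act_torsion.
Qed.

(** The torsion subgroup of the finitely generated abelian group
    gamma_i / gamma_(i+1) is finite. *)
Lemma isolator_finite_index i : rel_finite_index (isolator N i) (lcs N i.+1).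
Proof.
have /finite_seqP[L EL] := finite_lcomm i fY.
have [M MP] := torsion_finite (map (lcs_proj N i) L).
have /choice[f fP] : forall v, exists x, (exists2 y, isolator N i y & lcs_proj N i y = v) ->
    isolator N i x /\ lcs_proj N i x = v.
  move=> v; have [[y iy yv]|nv] := pselect (exists2 y, isolator N i y & lcs_proj N i y = v).
    by exists y.
  by exists 1%g.
have [_ [i1 _ _] _ _] := isolator_section sN i.
exists [seq if `[< isolator N i (f v) >] then f v else 1%g | v <- M]; split.
  by move=> _ /mapP[v _ ->]; case: asboolP.
move=> x [lx tx]; set v := lcs_proj N i x.
have [] := fP v; first by exists x.
move=> iv fv; exists (f v); last first.
  have [lf _] := iv; have lV := subgV (sv i) lf.
  apply/(lcs_proj_eq0 sN); first exact: (subgM (sv i)).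
  by rewrite pM// (additive_onV (sv i) (@pM i))// fv addNr.
apply/mapP; exists v; last by rewrite asboolT.
apply: MP => //; have := @lcs_proj_span _ Y i L; rewrite gY; apply => // y.
by rewrite EL.
Qed.

(** The next term is the kernel of the transfer [tau] to gamma_i(N) modulo the
    isolator. The transfer is invariant under conjugation by [K], since it is so on
    a power of each element and the target is torsion-free; hence commutators with
    [K] fall into the kernel. On gamma_i(N) the transfer is a nonzero multiple of
    the projection, so its kernel there is the isolator, in which gamma_(i+1)(N)
    has finite index. *)
Lemma central_series i : exists M : set G,
  [/\ is_subgroup M, M `<=` K & normalizes K M] /\
  [/\ lcs N i `<=` M, rel_finite_index M (lcs N i) & lcs K i `<=` M].
Proof.
elim: i => [|i [M [[sM MK nM] [NM MN KM]]]].
  exists K; split; split=> //.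
  by move=> x k Kx Kk; exact: subgJ.
have nB : normalizes M (lcs N i) by move=> x k Mk; apply: nlcs; exact: MK.
have [tau [p [p0 tM tN]]] := transfer sM (sv i) MN nB (free_projM sN (i:=i))
  (fun x a lx Ma => free_projJ lx (MK a Ma)).
have tJ x k : M x -> K k -> tau (x ^ k)%g = tau x.
  move=> Mx Kk; have [q q0 xq] := rel_finite_index_power sM (sv i) MN Mx.
  have Mxk : M (x ^ k)%g by exact: nM.
  apply/eqP; rewrite -subr_eq0; apply/eqP; apply: (free_quo_torsionfree sN q0).
  rewrite mulrnBl -!(additive_onX sM tM)// -conjXg !tN//; last exact: nlcs.
  by rewrite free_projJ// subrr.
pose M' := [set x | M x /\ tau x = 0].
have sM' : is_subgroup M'.
  split=> [|x y [Mx tx] [My ty]|x [Mx tx]]; split.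
  - exact: subg1.
  - exact: (additive_on1 sM tM).
  - exact: subgM.
  - by rewrite tM// tx ty addr0.
  - exact: subgV.
  - by rewrite (additive_onV sM tM)// tx oppr0.
have cM' x k : M x -> K k -> M' [~ x, k]%g.
  move=> Mx Kk; have Mxk : M (x ^ k)%g by exact: nM.
  have MV := subgV sM Mx; rewrite commgEl; split; first exact: subgM.
  by rewrite tM// (additive_onV sM tM)// tJ// addNr.
have isoM' : isolator N i `<=` M'.
  move=> x ix; have [lx _] := ix; split; first exact: NM.
  by rewrite tN//; have /(free_proj_eq0 sN lx) -> := ix; rewrite mul0rn.
have NM' : lcs N i.+1 `<=` isolator N i.
  move=> x lx; split; first exact: (lcsS sN).
  by rewrite (lcs_projS sN lx); exact: torsion0.
exists M'; split; split=> //.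
- by move=> x [/MK].
- move=> x k Kk Mx; rewrite -[(x ^ k)%g](mulVKg x) -(commgEl x k).
  by apply: (subgM sM') => //; apply: cM' => //; case: Mx.
- by move=> x /NM'/isoM'.
- apply: (rel_finite_index_trans sM' isoM' _ (isolator_finite_index i)).
  have [T [TM TN]] := MN.
  have /choice[f fP] : forall t, exists x, (exists2 y, M' y & lcs N i (t^-1 * y)%g) ->
      M' x /\ lcs N i (t^-1 * x)%g.
    move=> t; have [[y My ty]|nt] := pselect (exists2 y, M' y & lcs N i (t^-1 * y)%g).
      by exists y.
    by exists 1%g.
  exists [seq if `[< M' (f t) >] then f t else 1%g | t <- T]; split.
    by move=> _ /mapP[t _ ->]; case: asboolP => // _; exact: subg1.
  move=> x M'x; have [Mx tx] := M'x; have [t tT tx'] := TN x Mx.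
  have [|M'f lf] := fP t; first by exists x.
  exists (f t); first by apply/mapP; exists t => //; rewrite asboolT.
  have lfx : lcs N i ((f t)^-1 * x)%g.
    have -> : ((f t)^-1 * x = (t^-1 * f t)^-1 * (t^-1 * x))%g by rewrite !gnorm.
    by apply: (subgM (sv i)) => //; exact: (subgV (sv i)).
  apply/(free_proj_eq0 sN lfx); apply: (free_quo_torsionfree sN p0); rewrite -tN//.
  have [_ ->//] : M' ((f t)^-1 * x)%g.
  by apply: (subgM sM') => //; exact: (subgV sM').
- apply: generated_sub => // _ [[x k] [/= lx Kk] <-].
  by apply: cM' => //; exact: KM.
Qed.

(** The last term of [central_series] contains the trivial group with finite index.
    This is a form of Baer's theorem: finiteness modulo a term of the upper central
    series makes a term of the lower central series finite. *)
Theorem lcs_finite c : lcs N c = [set 1%g] -> finite_set (lcs K c).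
Proof.
move=> N1; have [M [_ [_ [T [_ TN]] KM]]] := central_series c.
apply: (sub_finite_set _ (finite_seq T)) => x /KM/TN[t tT].
by rewrite N1 => /= /eqP; rewrite mulg_eq1 => /eqP/invg_inj <-.
Qed.

End NilpotentByFinite.

(** * Ranks, and the action on the abelianization *)

Section Ranks.
Variables (G : groupType).
Implicit Types (x y z : G).

Lemma zindep_independent_mod (A B : set G) (V : zmodType) (f : G -> V) (s : seq G) :
  is_subgroup A -> additive_on A f -> (forall x, B x -> f x = 0) ->
  (forall x, x \in s -> A x) -> zindep (map f s) ->
  independent_mod B (fun i : 'I_(size s) => nth 1%g s i).
Proof.
move=> sA fM fB As si e Be i.
have An (j : 'I_(size s)) : A (nth 1%g s j) by apply: As; exact: mem_nth.
have := fB _ Be; rewrite (additive_on_prod sA fM); last first.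
  by move=> j _; exact: subgZ.
pose e' n := if insub n is Some j then e j else 0.
have e'E (j : 'I_(size s)) : e' j = e j by rewrite /e' valK.
move=> E; have := zindepP si (e := e'); rewrite size_map.
move=> /(_ _ i (ltn_ord i)); rewrite e'E; apply; rewrite -[RHS]E.
apply: eq_bigr => j _; rewrite (nth_map 1%g)// e'E.
by rewrite (additive_onZ sA fM).
Qed.

(** A level basis is one of the independent families whose sizes the rank bounds. *)
Lemma level_basis_rank (Y : set G) v (S : seq G) r : level_basis Y v S ->
  has_torsion_free_rank (lcs (generated Y) v) (lcs (generated Y) v.+1) r ->
  (size S <= r)%N.
Proof.
have sK := generated_subgroup Y.
move=> [Sl Si _] [_ rmax]; apply: (rmax _ (fun i => nth 1%g S i)).
  by move=> i; apply: lcomm_lcs; apply: Sl; exact: mem_nth.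
apply: (@zindep_independent_mod (lcs (generated Y) v) _ _ (lcs_proj (generated Y) v)) => //.
- exact: lcs_subgroup.
- exact: lcs_projM.
- by move=> x; exact: lcs_projS.
- by move=> x /Sl; exact: lcomm_lcs.
Qed.

(** Going down the lower central series of the overgroup, an element of [N] is, up
    to taking a power, a product of powers of the [t ^ q t] in [N] modulo the next
    term, and the remaining factor is treated in the same way. *)
Lemma abelianization_span (Y N : set G) c (S : nat -> seq G) :
  is_subgroup N -> N `<=` generated Y ->
  (forall x, generated Y x -> exists2 q, (0 < q)%N & N (x ^+ q)%g) ->
  (forall v, level_basis Y v (S v)) -> lcs (generated Y) c = [set 1%g] ->
  exists2 L : seq (quo (lcs N 0) (isolator N 0)),
    (size L = \sum_(v < c) size (S v))%N &
    forall x, N x -> qspan L (free_proj N 0 x).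
Proof.
set H := generated Y => sN NH Nq SB H1; have sH : is_subgroup H := generated_subgroup Y.
have sv i := lcs_subgroup sH i; set rho := free_proj N 0.
have rM : additive_on N rho := free_projM sN (i := 0).
have /choice[q qP] : forall x, exists q, H x -> (0 < q)%N /\ N (x ^+ q)%g.
  move=> x; have [Hx|nHx] := pselect (H x); last by exists 0%N.
  by have [q q0 xq] := Nq x Hx; exists q.
pose F v := [seq rho (t ^+ q t)%g | t <- S v].
pose L := flatten [seq F v | v <- iota 0 c]; exists L.
  rewrite size_flatten /shape -map_comp sumnE big_map -{1}(subn0 c) -/(index_iota 0 c) big_mkord.
  by apply: eq_bigr => v _; rewrite /= size_map.
have FL v u : (v < c)%N -> u \in F v -> u \in L.
  by move=> vc uF; apply/flattenP; exists (F v) => //; apply: map_f; rewrite mem_iota.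
have key k : (k <= c)%N -> forall x, N x -> lcs H (c - k) x -> qspan L (rho x).
  elim: k => [_ x Nx|k IH kc x Nx].
    rewrite subn0 H1 => ->; rewrite (additive_on1 sN rM).
    by apply: zspan_qspan; exact: zspan0.
  have E : (c - k = (c - k.+1).+1)%N by lia.
  rewrite E in IH; set v := (c - k.+1)%N in IH *.
  have vc : (v < c)%N by lia.
  have pM : additive_on (lcs H v) (lcs_proj H v) := lcs_projM sH (i := v).
  have [Sl _ Sq] := SB v.
  have span T : {subset T <= S v} -> forall y, N y -> lcs H v y ->
      zspan (map (lcs_proj H v) T) (lcs_proj H v y) -> qspan L (rho y).
    elim: T => [|t T IHT] TS y Ny vy /=.
      by move=> /(lcs_proj_eq0 sH vy); apply: IH => //; exact: ltnW.
    move=> [a ya]; have tS : t \in S v by apply: TS; rewrite mem_head.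
    have vt : lcs H v t := lcomm_lcs (Sl t tS).
    have [q0 Nt] := qP t (lcs_sub sH vt).
    pose tq := expgz (t ^+ q t)%g a.
    have Ntq : N tq := subgZ a sN Nt.
    have vtq : lcs H v tq := subgZ a (sv v) (subgX (q t) (sv v) vt).
    have : qspan L (rho (y ^+ q t * tq^-1)%g).
      have vV := subgV (sv v) vtq; have vX := subgX (q t) (sv v) vy.
      apply: IHT.
      - by move=> u uT; apply: TS; rewrite inE uT orbT.
      - by apply: (subgM sN); [exact: (subgX _ sN)|exact: (subgV sN)].
      - exact: (subgM (sv v)).
      rewrite pM// (additive_onV (sv v) pM)// (additive_onX (sv v) pM)//.
      rewrite (additive_onZ (sv v) pM); last exact: (subgX _ (sv v)).
      rewrite (additive_onX (sv v) pM)//.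
      rewrite -[_ *+ _ *~ a]/((_ *~ (q t)%:Z) *~ a) mulrzAC -[_ *~ (q t)%:Z]/(_ *+ q t).
      by rewrite -mulrnBl; exact: zspanMn.
    rewrite rM//; [|exact: (subgX _ sN)|exact: (subgV sN)].
    rewrite (additive_onV sN rM)// (additive_onX sN rM)// (additive_onZ sN rM)// => yq.
    apply: (qspan_div q0); rewrite -[_ *+ _](subrK (rho (t ^+ q t)%g *~ a)).
    apply: qspanD => //; apply: qspanMz; apply: zspan_qspan; apply: zspan_mem.
    by apply: (FL v) => //; exact: (map_f (fun t => rho (t ^+ q t)%g)).
  move=> vx; have [m m0 xm] := Sq x vx.
  apply: (qspan_div m0); rewrite -(additive_onX sN rM)//.
  apply: (span (S v)) => //; [exact: (subgX _ sN)|exact: (subgX _ (sv v))|].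
  by rewrite (additive_onX (sv v) pM).
move=> x Nx; apply: (key c) => //; rewrite subnn; exact: NH.
Qed.

End Ranks.

(** Adding an identity block; this is the monotonicity of the maximal order of a
    finite subgroup of GL_k(Z). *)
Lemma finite_GLZ_subgroup_pad k l (S : {fset 'M[int]_k}) : finite_GLZ_subgroup S ->
  exists2 S' : {fset 'M[int]_(k + l)}, finite_GLZ_subgroup S' & #|` S'| = #|` S|.
Proof.
move=> [Su S1 SM SV].
pose phi (M : 'M[int]_k) : 'M[int]_(k + l) := block_mx M 0 0 1%:M.
have phiM M N : phi M *m phi N = phi (M *m N).
  by rewrite /phi mulmx_block !mulmx0 !mul0mx !addr0 mulmx1 add0r.
have phi1 : phi 1%:M = 1%:M by rewrite /phi -scalar_mx_block.
have phi_inj : injective phi by move=> M N /eq_block_mx[].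
have phiV M : M \in unitmx -> phi M \in unitmx /\ invmx (phi M) = phi (invmx M).
  move=> Mu; have E : phi M *m phi (invmx M) = 1%:M by rewrite phiM mulmxV.
  have [pu _] := mulmx1_unit E; split=> //.
  by rewrite -[LHS]mulmx1 -E mulKmx.
exists [fset phi M | M in S]%fset; last by rewrite card_imfset.
split.
- by move=> _ /imfsetP[M /= /Su Mu ->]; case: (phiV M Mu).
- by apply/imfsetP; exists 1%:M.
- move=> _ _ /imfsetP[M /= MS ->] /imfsetP[N /= NS ->].
  by rewrite phiM; apply: in_imfset; exact: SM.
- move=> _ /imfsetP[M /= MS ->]; have [_ ->] := phiV M (Su M MS).
  by apply: in_imfset; exact: SV.
Qed.

Section Action.
Variables (G : groupType) (Y N : set G).
Hypotheses (fY : finite_set Y) (gY : generated Y = N).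
Hypothesis (nN : forall x g, N x -> N (x ^ g)%g).
Hypothesis (fN : finite_index N).

Let sN : is_subgroup N.
Proof. by rewrite -gY; exact: generated_subgroup. Qed.
Local Notation V := (quo (lcs N 0) (isolator N 0)).
Let rho : G -> V := free_proj N 0.
Let rM : additive_on N rho := free_projM sN (i := 0).

Lemma rho_surj (v : V) : exists2 x, N x & rho x = v.
Proof. exact: (qproj_surj v (isolator_section sN 0)). Qed.

Lemma rho_span : exists s : seq V, forall v, zspan s v.
Proof.
have /finite_seqP[L EL] := finite_lcomm 0 fY.
exists (map rho L) => v; have [x Nx <-] := rho_surj v.
have : generated Y x by rewrite gY.
move=> /(_ [set x | N x /\ zspan (map rho L) (rho x)])[]//; split.
  split=> [|y z [Ny sy] [Nz sz]|y [Ny sy]] /=; split.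
  - exact: (subg1 sN).
  - by rewrite (additive_on1 sN rM); exact: zspan0.
  - exact: (subgM sN).
  - by rewrite rM//; exact: zspanD.
  - exact: (subgV sN).
  - by rewrite (additive_onV sN rM)//; exact: zspanN.
move=> y Yy /=; split; first by rewrite -gY; exact: sub_generated.
by apply: zspan_mem; apply: map_f; have : lcomm Y 0 y by [left]; rewrite EL.
Qed.

Lemma isolator_conj x g : isolator N 0 x -> isolator N 0 (x ^ g)%g.
Proof.
move=> [Nx [m m0 xm]]; have Nxg : N (x ^ g)%g by exact: nN.
split=> //; exists m => //; have pM : additive_on N (lcs_proj N 0) := lcs_projM sN (i := 0).
rewrite -(additive_onX sN pM)// -conjXg; apply: (lcs_projS sN).
apply: lcs_normal_by => //; first by move=> y; exact: nN.
by apply/(lcs_proj_eq0 sN); [exact: (subgX m sN Nx)|rewrite (additive_onX sN pM)].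
Qed.

Lemma rho_conj_eq x y g : N x -> N y -> rho x = rho y -> rho (x ^ g)%g = rho (y ^ g)%g.
Proof.
move=> Nx Ny xy; have NV := subgV sN Nx.
have Ny' : N (x^-1 * y)%g by exact: (subgM sN).
have /(free_proj_eq0 sN (i := 0) Ny')/(isolator_conj g) iyg : rho (x^-1 * y)%g = 0.
  by rewrite rM// (additive_onV sN rM)// xy addNr.
rewrite -[y](mulVKg x) conjMg (rM (nN g Nx) (nN g Ny')).
by have /(free_proj_eq0 sN (i := 0) (nN g Ny')) := iyg; rewrite -/rho => ->; rewrite addr0.
Qed.

(** [K] consists of the elements that act trivially by conjugation on a basis of
    the abelianization of [N] modulo torsion. The matrix of the action separates the
    cosets of [K] and has finitely many values, because [N] acts trivially; these
    matrices form a finite subgroup of GL_k(Z), where [k <= h <= k']. *)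
Lemma action_kernel (k' m h : nat) :
  (forall k (x : 'I_k -> V), zfree x -> (k <= h)%N) -> (h <= k')%N -> is_max_GLZ_order k' m ->
  exists K : set G, [/\ is_subgroup K, N `<=` K,
    forall x k, N x -> K k -> exists2 m, (0 < m)%N & lcs N 1 ([~ x, k] ^+ m)%g
    & exists (T : eqType) (mu : G -> T) S, coset_map K mu S /\ (size S <= m)%N].
Proof.
move=> rk hk' [_ maxm].
have [s gs] := rho_span.
have [k [x [xg xf]]] := free_basis gs (fun v m => @free_quo_torsionfree _ _ sN 0 v m).
have /choice[b bP] : forall i, exists b, N b /\ rho b = x i.
  by move=> i; have [b Nb bx] := rho_surj (x i); exists b.
have Nb i : N (b i) by case: (bP i).
have bx i : rho (b i) = x i by case: (bP i).
have /choice[a aP] : forall gi : G * 'I_k, exists e : 'I_k -> int,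
    rho (b gi.2 ^ gi.1)%g = \sum_j x j *~ e j.
  by move=> gi; exact: xg.
pose M g : 'M[int]_k := \matrix_(i, j) a (g, i) j.
have ME g i : rho (b i ^ g)%g = \sum_j x j *~ M g i j.
  by rewrite (aP (g, i)); apply: eq_bigr => j _; rewrite mxE.
have uniq_coord (e e' : 'I_k -> int) : \sum_j x j *~ e j = \sum_j x j *~ e' j -> forall j, e j = e' j.
  move=> E j; apply/eqP; rewrite -subr_eq0; apply/eqP; move: j.
  apply: (xf (fun j => e j - e' j)); under eq_bigr do rewrite mulrzBr.
  by rewrite sumrB E subrr.
have act y g (e : 'I_k -> int) : N y -> rho y = \sum_i x i *~ e i ->
    rho (y ^ g)%g = \sum_i rho (b i ^ g)%g *~ e i.
  move=> Ny ye; pose y' := (\prod_i expgz (b i) (e i))%g.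
  have Ny' : N y' by apply: subg_prod => // i _; exact: subgZ.
  have fM : additive_on N (fun z => rho (z ^ g)%g).
    by move=> u v Nu Nv; rewrite conjMg (rM (nN g Nu) (nN g Nv)).
  rewrite (@rho_conj_eq y y')//.
    rewrite (additive_on_prod sN fM); last by move=> i _; exact: subgZ.
    by apply: eq_bigr => i _; rewrite (additive_onZ sN fM).
  rewrite ye (additive_on_prod sN rM); last by move=> i _; exact: subgZ.
  by apply: eq_bigr => i _; rewrite (additive_onZ sN rM)// bx.
have MM g h' : M (g * h')%g = M g *m M h'.
  apply/matrixP => i j; rewrite [RHS]mxE; move: j; apply: uniq_coord.
  rewrite -ME conjgM (act _ _ (fun j => M g i j)) ?ME//; last exact: nN.
  under eq_bigr => j _ do rewrite ME mulrz_suml.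
  rewrite exchange_big /=; apply: eq_bigr => l _; rewrite mulrz_sumr.
  by apply: eq_bigr => j _; rewrite -mulrzA mulrC.
have MN n : N n -> M n = 1%:M.
  move=> Nn; apply/matrixP => i j; move: j; apply: uniq_coord.
  rewrite -ME (additive_onJ sN rM)// bx (bigD1 i)//= big1 ?addr0; last first.
    by move=> j ji; rewrite mxE eq_sym (negbTE ji) mulr0z.
  by rewrite mxE eqxx mulr1z.
have M1 : M 1%g = 1%:M by apply: MN; exact: (subg1 sN).
have MVl g : M g^-1%g *m M g = 1%:M by rewrite -MM mulVg.
have MVr g : M g *m M g^-1%g = 1%:M by rewrite -MM mulgV.
have Mu g : M g \in unitmx by case: (mulmx1_unit (MVr g)).
have MV g : M g^-1%g = invmx (M g) by rewrite -[LHS](mulmxK (Mu g)) MVl mul1mx.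
pose K := [set g | M g = 1%:M].
have sK : is_subgroup K.
  split=> [//|g h' gK hK|g gK].
    by have := MM g h'; rewrite gK hK mulmx1.
  by have := MV g; rewrite gK invmx1.
have fin : finite_set (range M).
  have [T [nu [U [nuE nuU]]]] := fN.
  have /choice[t tP] : forall m, exists t, (exists g, nu g = m) -> nu t = m.
    move=> m'; have [[g gm]|nm] := pselect (exists g, nu g = m'); last by exists 1%g.
    by exists g.
  apply: (sub_finite_set _ (finite_seq [seq M (t u) | u <- U])) => _ [g _ <-] /=.
  apply/mapP; exists (nu g) => //.
  have /nuE/MN : nu g = nu (t (nu g)) by apply/esym/tP; exists g.
  by rewrite MM MV => E; rewrite -[LHS](mulmxKV (Mu (t (nu g)))) E mul1mx.
pose S := fset_set (range M).
have SE A : A \in S <-> exists g, M g = A.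
  rewrite in_fset_set//; split; first by rewrite inE => -[g _ gA]; exists g.
  by move=> [g gA]; rewrite inE; exists g.
have SG : finite_GLZ_subgroup S.
  split.
  - by move=> _ /SE[g <-].
  - by apply/SE; exists 1%g.
  - by move=> _ _ /SE[g <-] /SE[h' <-]; apply/SE; exists (g * h')%g.
  - by move=> _ /SE[g <-]; apply/SE; exists g^-1%g.
have cardS : (#|` S| <= m)%N.
  have kk' : (k <= k')%N by exact: leq_trans (rk k x xf) hk'.
  (* The bound [m] concerns matrices of size [k']. *)
  have [S' S'G <-] := finite_GLZ_subgroup_pad (k' - k) SG.
  by move: S' S'G; rewrite subnKC// => S' S'G; exact: maxm.
exists K; split=> //.
- move=> y g Ny Kg; have NV := subgV sN Ny.
  have Nr : N [~ y, g]%g by rewrite commgEl; apply: (subgM sN) => //; exact: nN.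
  have : rho [~ y, g]%g = 0.
    have [e ye] := xg (rho y).
    rewrite commgEl (rM NV (nN g Ny)).
    rewrite (additive_onV sN rM)// (act y g e Ny ye) ye.
    apply/eqP; rewrite addrC subr_eq0; apply/eqP; apply: eq_bigr => i _.
    congr (_ *~ _); rewrite ME Kg (bigD1 i)//= big1 ?addr0; last first.
      by move=> j ji; rewrite mxE eq_sym (negbTE ji) mulr0z.
    by rewrite mxE eqxx mulr1z.
  move=> /(free_proj_eq0 sN (i := 0) Nr)[_ [p p0 rp]]; exists p => //.
  have pM : additive_on N (lcs_proj N 0) := lcs_projM sN (i := 0).
  apply/(lcs_proj_eq0 sN); first exact: (subgX p sN Nr).
  by rewrite (additive_onX sN pM).
- exists ('M[int]_k : eqType), M, S; split=> //; split=> [g h'|g]; last by apply/SE; exists g.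
  rewrite /K /= MM MV; split=> [->|E]; first exact: mulmxV.
  by rewrite -[LHS](mulmxKV (Mu h')) E mul1mx.
Qed.

End Action.

(** * Growth of virtually nilpotent groups, and the theorem *)

(** The constant [2 * p * F] that appears when a ball of [X] is compared with a ball
    of the Schreier generators of a subgroup of index [p], doubled to absorb a
    Euclidean division, is at most [p * 8 ^ d]. *)
Lemma power_cost_bound d : (0 < d)%N -> (4 * (d * power_cost d.-1) <= 8 ^ d)%N.
Proof.
case: d => // d _; rewrite /power_cost succnK.
have key : (2 * d.+1 * (3 * d + 1) <= 4 ^ d.+1)%N.
  case: d => [//|d]; elim: d => [//|d IH].
  by move: IH; rewrite [in X in _ -> X]expnS; nia.
rewrite -[8%N]/(4 * 2)%N expnMn.
apply: leq_trans (_ : 2 * d.+1 * (3 * d + 1) * 2 ^ d.+1 <= _)%N; last by rewrite leq_mul2r key orbT.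
by rewrite expnS; nia.
Qed.

(** The upper bound is applied to [H], where it gives [d <= c * h] unless the degree
    is at most [d - 1], and to [K], where it shows that the lower bound has exponent
    at least [d] under the same proviso. *)
Theorem virtually_nilpotent_growth (R : realType) (G : groupType) (X H : set G)
    (c h k g d : nat) :
  generating_set X -> is_subgroup H -> finite_set (left_cosets H) ->
  nilpotent_of_class H c -> has_hirsch_length H h -> (h <= k)%N ->
  is_max_GLZ_order k g -> (0 < d)%N ->
  (growth_degree R G <= (d%:R - 1)%:E)%E \/
  (d <= c * h)%N /\ forall n, (n ^ d <= growth X n * (g * 8 ^ d) ^ d)%N.
Proof.
move=> gX sH fH [H1 _] [c' [r [[H1' min_c] rk hE]]] hk maxg d0.
have cc' : (c' <= c)%N by exact: min_c.
have fX : finite_set X by case: gX.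
have small D B : (forall n, (0 < n)%N -> (growth X n <= B * n ^ D)%N) -> (D < d)%N ->
    (growth_degree R G <= (d%:R - 1)%:E)%E.
  move=> /(growth_degree_le R gX) deg Dd; apply: (le_trans deg).
  by rewrite lee_fin lerBrDr natr1 ler_nat.
have fiH := left_cosets_finite_index sH fH.
have [T [mu [S muH]]] := fiH.
(* In the upper bound from [H] the weights are at most [c'] and the numbers of
   basis commutators add up to at most [h]. *)
have [YH [NH [fYH gYH _ XYH]]] := schreier muH sH gX.
have /choice[SH SHP] : forall v, exists L, level_basis YH v L.
  by move=> v; exact: level_basis_exists.
have SHr v : (v < c')%N -> (size (SH v) <= r v)%N.
  by move=> vc; apply: (level_basis_rank (SHP v)); rewrite gYH; exact: rk.
have [|BH HBH] := growth_upper_bound R (c := c') fYH SHP.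
  by rewrite gYH H1'; exact: finite_set1.
have [Dd|dD] := ltnP (\sum_(v < c') v.+1 * size (SH v)) d.
  left; apply: (small _ (BH * NH)%N) Dd => n n0; apply: leq_trans (XYH n) _.
  by rewrite mulnAC leq_mul2r HBH ?orbT.
have dch : (d <= c * h)%N.
  apply: (leq_trans dD); rewrite hE big_distrr /=; apply: leq_sum => v _.
  by apply: leq_mul; [exact: leq_trans (ltn_ord v) cc'|exact: SHr].
(* A normal subgroup is required for [G] to act on its abelianization. *)
pose N := core H.
have sN : is_subgroup N := core_subgroup sH.
have fiN : finite_index N := finite_index_core sH fiH.
have nN x y : N x -> N (x ^ y)%g := @core_normal _ H x y.
have N1 : lcs N c' = [set 1%g].
  apply/seteqP; split=> [x /(lcs_subset (@core_sub _ H))|_ ->]; first by rewrite H1'.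
  exact: (subg1 (lcs_subgroup sN c')).
have [TN [nu [U nuN]]] := fiN.
have [YN [_ [fYN gYN _ _]]] := schreier nuN sN gX.
have [L sL spanL] : exists2 L : seq (quo (lcs N 0) (isolator N 0)),
    (size L = \sum_(v < c') size (SH v))%N &
    forall x, N x -> qspan L (free_proj N 0 x).
  apply: (abelianization_span (Y := YH) sN) => //; rewrite gYH//; first exact: core_sub.
  by move=> x _; exact: (finite_index_power nuN).
have rkN k0 (x : 'I_k0 -> quo (lcs N 0) (isolator N 0)) : zfree x -> (k0 <= h)%N.
  move=> xf; apply: leq_trans (steinitz xf (s := L) _) _.
    move=> i; have [y Ny <-] := qproj_surj (x i) (isolator_section sN 0).
    exact: spanL.
  by rewrite sL hE; apply: leq_sum => v _; exact: SHr.
have [K [sK NK tK [TK [xi [SK [xiK sSK]]]]]] := action_kernel fYN gYN nN fiN rkN hk maxg.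
have [YK [NKn [fYK gYK YKX XYK]]] := schreier xiK sK gX.
have KN : rel_finite_index K N.
  have [nuE nuU] := nuN.
  have /choice[t tP] : forall m, exists t, (exists2 y, K y & nu y = m) -> K t /\ nu t = m.
    move=> m; have [[y Ky ym]|nm] := pselect (exists2 y, K y & nu y = m); last by exists 1%g.
    by exists y.
  exists [seq if `[< K (t u) >] then t u else 1%g | u <- U]; split.
    by move=> _ /mapP[u _ ->]; case: asboolP => // _; exact: subg1.
  move=> x Kx; have [|Kt tx] := tP (nu x); first by exists x.
  exists (t (nu x)).
    by apply/mapP; exists (nu x) => //; rewrite asboolT.
  have /nuE Nx : nu x = nu (t (nu x)) by [].
  by have := nN _ (t (nu x)) Nx; rewrite conjgE mulgVK.
have fK : finite_set (lcs K c') := lcs_finite fYN gYN sK NK (fun x k Kk Nx => nN x k Nx) KN tK N1.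
have /choice[SKb SKP] : forall v, exists L, level_basis YK v L.
  by move=> v; exact: level_basis_exists.
have [|BK HBK] := growth_upper_bound R (c := c') fYK SKP; first by rewrite gYK.
have [Dd|dDK] := ltnP (\sum_(v < c') v.+1 * size (SKb v)) d.
  left; apply: (small _ (BK * NKn)%N) Dd => n n0; apply: leq_trans (XYK n) _.
  by rewrite mulnAC leq_mul2r HBK ?orbT.
right; split=> // n.
set p := size SK in sSK YKX *; set F := (d * power_cost d.-1)%N.
have p0 : (0 < p)%N by rewrite /p; case: (SK) xiK => // -[_ /(_ 1%g)].
have F0 : (0 < F)%N by rewrite !muln_gt0 d0 addn1 expn_gt0.
have FL : (4 * F <= 8 ^ d)%N by exact: power_cost_bound.
have FE : F = (d * power_cost d.-1)%N by [].
clearbody F.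
(* For [n] below the constant the identity element is enough. Above it, a ball of
   radius [F * m] for [YK] fits into the ball of radius [n] for [X], where the
   quotient [m] is at least half of the exact ratio. *)
have [m0|m0] := posnP (n %/ (2 * p * F))%N.
  apply: leq_trans (_ : (g * 8 ^ d) ^ d <= _)%N; last by rewrite leq_pmull// growth_gt0.
  rewrite leq_exp2r//; have := ltn_ceil n (_ : 0 < 2 * p * F)%N.
  rewrite m0 mul1n !muln_gt0 p0 F0 => /(_ isT)/ltnW/leq_trans; apply.
  by apply: leq_trans (leq_mul sSK FL); nia.
set m := (n %/ _)%N in m0.
apply: leq_trans (_ : m ^ d * (g * 8 ^ d) ^ d <= _)%N.
  rewrite -expnMn leq_exp2r//; have := ltn_ceil n (_ : 0 < 2 * p * F)%N.
  rewrite -/m !muln_gt0 p0 F0 => /(_ isT)/ltnW/leq_trans; apply.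
  apply: leq_trans (_ : m * (p * (4 * F)) <= _)%N; first by nia.
  by rewrite leq_mul2l leq_mul ?orbT.
rewrite leq_mul2r; apply/orP; right.
apply: leq_trans (growth_lower_bound fYK SKP d0 m0 dDK) _.
apply: fsubset_leq_card; rewrite -fset_set_sub; [|exact: finite_word_ball|exact: finite_word_ball].
apply: subset_trans (word_ball_sub YKX) _; apply: word_ball_le.
rewrite -FE; have := leq_trunc_div n (2 * p * F); rewrite -/m; nia.
Qed.

Section Numeric.
Variables (R : realType) (C : R) (d : nat).
Hypotheses (C0 : 0 < C) (d0 : (0 < d)%N).
Let k := Num.truncn (C ^+ d).
Let g := max_GLZ_order k.

Lemma epsilon_le_expR : epsilon C d <= 1 / expR (d%:R * expR (C * d%:R `^ C)).
Proof. by rewrite /epsilon ge_min lexx orbT. Qed.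

Lemma epsilon_le1 : epsilon C d <= 1.
Proof.
apply: le_trans epsilon_le_expR _; rewrite ler_pdivrMr ?expR_gt0// mul1r -expR0 ler_expR.
by rewrite mulr_ge0// expR_ge0.
Qed.

(** If the maximum did not exist then [max_GLZ_order] would be 0 by convention, and
    so would be the first term of the minimum defining [epsilon]. *)
Lemma epsilon_max_GLZ_order : 0 < epsilon C d -> is_max_GLZ_order k g.
Proof.
rewrite /epsilon lt_min -/k -/g => /andP[+ _].
have [ex|nex] := pselect (exists m, is_max_GLZ_order k m).
  by move=> _; exact: (xgetPex 0%N ex).
have -> : g = 0%N.
  by rewrite /g /max_GLZ_order; case: xgetP => // y _ Py; case: nex; exists y.
by rewrite powR0 ?mulr0 ?div1r ?invr0 ?ltxx// gt_eqF// exprn_gt0.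
Qed.

Lemma epsilon_threshold (n : nat) : n%:R <= expR (expR (C * d%:R `^ C)) :> R ->
  epsilon C d * n%:R ^+ d <= 1.
Proof.
move=> nE; apply: le_trans (ler_wpM2r _ epsilon_le_expR) _; first by rewrite exprn_ge0.
rewrite mul1r mulrC ler_pdivrMr ?expR_gt0// mul1r expRM_natl.
by apply: lerXn2r => //; rewrite ?nnegrE ?expR_ge0.
Qed.

(** [d <= c * h <= C ^ (2 d)] turns the exponents [d] and [3 d d] of [g] and [2]
    in [(g * 8 ^ d) ^ d] into those of [epsilon]. *)
Lemma epsilon_bound (c h n s : nat) : c%:R <= C ^+ d -> h%:R <= C ^+ d ->
  (d <= c * h)%N -> (0 < g)%N -> (n ^ d <= s * (g * 8 ^ d) ^ d)%N ->
  epsilon C d * n%:R ^+ d <= s%:R.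
Proof.
move=> cC hC dch g0 ns.
have dC : d%:R <= C ^+ (2 * d).
  apply: le_trans (_ : (c * h)%:R <= _); first by rewrite ler_nat.
  by rewrite natrM mul2n -addnn exprD ler_pM.
have ddC : (d * d)%:R <= C ^+ (4 * d).
  have E : (4 * d = 2 * d + 2 * d)%N by lia.
  by rewrite natrM E exprD; exact: ler_pM.
have g1 : 1 <= g%:R :> R by rewrite ler1n.
have gC : (g ^ d)%:R <= g%:R `^ (C ^+ (2 * d)).
  by rewrite natrX -(powR_mulrn d (ler0n R g)); exact: ler_powR.
have eC : ((8 ^ d) ^ d)%:R <= 2 `^ (3 * C ^+ (4 * d)) :> R.
  rewrite -[8%N]/(2 ^ 3)%N -!expnM natrX -(powR_mulrn _ (ler0n R 2)); apply: ler_powR.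
    by rewrite ler1n.
  by rewrite natrM ler_wpM2l.
set a := 2 `^ _ in eC; set b := g%:R `^ _ in gC.
have a0 : 0 < a by apply: lt_le_trans eC; rewrite ltr0n !expn_gt0.
have b0 : 0 < b by apply: lt_le_trans gC; rewrite ltr0n expn_gt0 g0.
apply: le_trans (_ : 1 / (a * b) * n%:R ^+ d <= _).
  by apply: ler_wpM2r; [rewrite exprn_ge0|rewrite /epsilon ge_min lexx].
rewrite mul1r mulrC ler_pdivrMr ?mulr_gt0//.
apply: le_trans (_ : (s * (g * 8 ^ d) ^ d)%:R <= _); first by rewrite -natrX ler_nat.
rewrite natrM ler_wpM2l// expnMn mulnC natrM; exact: ler_pM.
Qed.

End Numeric.

Theorem theorem1p6 (R : realType) (C : R) (I : nat -> R -> R)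
    (CI : shalom_tao C I) (d : nat) (d_gt0 : (0 < d)%N) :
  (forall (G : groupType) (X : set G), generating_set X ->
     forall n : nat, (0 < n)%N ->
       (growth X n)%:R < epsilon C d * n%:R ^+ d ->
       (exists H : set G,
          [/\ is_subgroup H, is_nilpotent H & index_le H (I n d%:R)]) /\
       (growth_degree R G <= (d%:R - 1)%:E)%E)
  /\
  (forall (G : groupType) (X : set G),
     (d%:R%:E <= growth_degree R G)%E -> generating_set X ->
     forall n : nat, (0 < n)%N ->
       epsilon C d * n%:R ^+ d <= (growth X n)%:R).
Proof.
have [C0 ST] := CI.
have part1 (G : groupType) (X : set G) : generating_set X -> forall n : nat, (0 < n)%N ->
    (growth X n)%:R < epsilon C d * n%:R ^+ d ->
    (exists H : set G, [/\ is_subgroup H, is_nilpotent H & index_le H (I n d%:R)]) /\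
    (growth_degree R G <= (d%:R - 1)%:E)%E.
  move=> gX n n0 lt; have fX : finite_set X by case: gX.
  have s1 : 1 <= (growth X n)%:R :> R by rewrite ler1n growth_gt0.
  have nE : expR (expR (C * d%:R `^ C)) <= n%:R.
    rewrite leNgt; apply/negP => /ltW/(epsilon_threshold (d := d)) le1.
    by have := lt_le_trans (le_lt_trans s1 lt) le1; rewrite ltxx.
  have nX0 : 0 < n%:R ^+ d :> R by rewrite exprn_gt0// ltr0n.
  have e0 : 0 < epsilon C d.
    by rewrite -(pmulr_lgt0 _ nX0) (lt_trans _ lt)// (lt_le_trans _ s1).
  have sn : (growth X n)%:R <= n%:R `^ d%:R :> R.
    rewrite powR_mulrn//; apply: (le_trans (ltW lt)).
    by rewrite ler_piMl ?epsilon_le1// ltW.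
  have d1 : 1 <= d%:R :> R by rewrite ler1n.
  have [[H [c [h [sH iH [ncH cC] [hH hC]]]]] _] := ST G X gX d%:R n d1 nE sn.
  rewrite (powR_mulrn _ (ltW C0)) in cC hC.
  split; first by exists H; split=> //; exists c.
  have maxg := epsilon_max_GLZ_order C0 e0.
  have g0 : (0 < max_GLZ_order (Num.truncn (C ^+ d)))%N.
    have [[S [_ S1 _ _] <-] _] := maxg.
    by rewrite cardfs_gt0; apply/fset0Pn; exists 1%:M.
  have Cd0 : 0 <= C ^+ d by apply: exprn_ge0; exact: ltW.
  have hk : (h <= Num.truncn (C ^+ d))%N by rewrite truncn_ge_nat.
  have fcH : finite_set (left_cosets H) by case: iH.
  have [//|[dch low]] := virtually_nilpotent_growth R gX sH fcH ncH hH hk maxg d_gt0.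
  have := epsilon_bound C0 d_gt0 cC hC dch g0 (low n).
  by rewrite leNgt lt.
split=> // G X dG gX n n0; rewrite leNgt; apply/negP => lt.
have [_ /(le_trans dG)] := part1 G X gX n n0 lt.
by rewrite lee_fin lerBrDr gerDl leNgt ltr01.
Qed.
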